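(* Let $M$ be a 3-dimensional spherical CR manifold with a CR triangulation $M=\Delta_1\cup\cdots\cup\Delta_k$, each $\Delta_i$ a CR tetrahedron. Suppose $M$ is non-compact (with the triangulation ideal) with purely parabolic boundary. Then its invariant $$\beta(M)=\sum_{i=1}^k\beta(\Delta_i)\in\mathcal{P}(\mathbb{C}),\qquad \beta(\Delta_i)=[z^i_{01}]+[z^i_{10}]+[z^i_{23}]+[z^i_{32}],$$ lies in $\mathcal{B}(\mathbb{C})$, that is, $\sum_i\delta(\beta(\Delta_i))=0$ in $\bigwedge^2\mathbb{C}^*$.
   Context: Pre-Bloch group: for a field $F$, $\mathcal{P}(F)$ is the quotient of the free abelian group $\mathbb{Z}[F\setminus\{0,1\}]$ by the subgroup generated by $[x]-[y]+[\frac{y}{x}]-[\frac{1-x^{-1}}{1-y^{-1}}]+[\frac{1-x}{1-y}]$ for $x\neq y$ in $F\setminus\{0,1\}$. $\bigwedge^2F^*$ is $F^*\otimes_{\mathbb{Z}}F^*$ modulo the subgroup generated by all $x\otimes y+y\otimes x$. The Bloch group $\mathcal{B}(F)$ is the kernel of $\delta:\mathcal{P}(F)\to\bigwedge^2F^*$, $\delta([z])=z\wedge(1-z)$. $\mathbb{C}^{2,1}$ is $\mathbb{C}^3$ with the Hermitian form $\langle z,w\rangle=w^*Jz$, $J=\begin{pmatrix}0&0&1\\0&1&0\\1&0&0\end{pmatrix}$. $S^3\subset\mathbb{C}P^2$ is the set of null lines, and $PU(2,1)$ is the projectivized unitary group of this form. A $\mathbb{C}$-circle is the intersection with $S^3$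 of a complex projective line which meets $S^3$ in more than one point. Four points of $S^3$ are generic if they are pairwise distinct and no three of them lie on a common $\mathbb{C}$-circle. Cross-ratio invariants: for a generic quadruple $(p_0,p_1,p_2,p_3)$, with lifts $\hat p_i\in\mathbb{C}^{2,1}$, and $(i,j,k,l)$ an even permutation of $(0,1,2,3)$, $$z_{ij}=\frac{\langle \hat p_l,c_{ij}\rangle\langle\hat p_k,\hat p_i\rangle}{\langle\hat p_k,c_{ij}\rangle\langle\hat p_l,\hat p_i\rangle}\in\mathbb{C}\setminus\{0,1\},$$ where $c_{ij}\neq0$ satisfies $\langle\hat p_i,c_{ij}\rangle=\langle\hat p_j,c_{ij}\rangle=0$. For the tetrahedron $\Delta_s$ the invariants $z^s_{ij}$ are those of its vertices, ordered consistently with the orientation. A spherical CR manifold is a 3-manifold with an $(S^3,PU(2,1))$-geometric structure. A CR tetrahedron is a tetrahedron whose vertices are given by a generic quadruple of points of $S^3$. A CR triangulation of $M$ is a (possibly singular) triangulation by finitely many tetrahedra, such that, developing the triangulation in $S^3$ (equivariantly for the holonomy representation $\pi_1(M)\to PU(2,1)$), every tetrahedron becomes a CR tetrahedron; the faces are glued in pairs by elements of $PU(2,1)$ (side pairings), which generate the holonomy group. Ideal: $M$ is the interior of a compact manifold with boundary, the tetrahedra triangulate the space obtained by collapsing each boundary component to a point, and the vertices are exactly these collapsed points. Purely parabolic boundary: every element of the holonomy group fixing a vertex of the developed triangulation is purely parabolic (i.e. parabolic and represented by a unipotent matrix) or the identity. *)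

(* Defs.v *)
From HB Require Import structures.
From mathcomp Require Import all_boot all_order all_algebra.
From mathcomp Require Import perm.
From mathcomp Require Import all_classical all_reals all_analysis.
From mathcomp Require Import complex ring_quotient.
From mathcomp Require Import freeg.
From mathcomp Require Import ring.

Set Implicit Arguments.
Unset Strict Implicit.
Unset Printing Implicit Defensive.

Import Order.TTheory GRing.Theory Num.Theory.
Import numFieldNormedType.Exports.

Local Open Scope classical_set_scope.
Local Open Scope ring_scope.

Definition gen_subgroup (V : zmodType) (X : set V) : {pred V} := fun v =>
  `[< forall S : set V, S 0 -> (forall x y, S x -> S y -> S (x - y)) ->
      X `<=` S -> S v >].

Lemma gen_subgroup_closed (V : zmodType) (X : set V) :
  zmod_closed (gen_subgroup X).
Proof.
split=> [|x y]; rewrite !unfold_in.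
  by apply/asboolP => S S0.
move=> /asboolP Sx /asboolP Sy; apply/asboolP => S S0 SB XS.
by apply: (SB); [exact: Sx|exact: Sy].
Qed.

HB.instance Definition _ (V : zmodType) (X : set V) :=
  GRing.isZmodClosed.Build V (gen_subgroup X) (gen_subgroup_closed X).

Definition zquot (V : zmodType) (X : set V) : zmodType :=
  Quotient.quot (gen_subgroup X).

Definition zproj (V : zmodType) (X : set V) : V -> zquot X :=
  \pi_(Quotient.quot (gen_subgroup X))%qT.

Lemma zproj_is_zmod_morphism (V : zmodType) (X : set V) :
  zmod_morphism (@zproj V X).
Proof. by move=> x y; rewrite /zproj; exact: (raddfB _ x y). Qed.

HB.instance Definition _ (V : zmodType) (X : set V) :=
  GRing.isZmodMorphism.Build V (zquot X) (@zproj V X)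
    (zproj_is_zmod_morphism X).

Lemma zproj_eq0 (V : zmodType) (X : set V) v :
  (@zproj V X v == 0) = (v \in gen_subgroup X).
Proof.
by rewrite -(raddf0 (@zproj V X)) /zproj -Quotient.idealrBE subr0.
Qed.

Lemma zproj_eq0_gen (V : zmodType) (X : set V) v : X v -> @zproj V X v = 0.
Proof.
by move=> Xv; apply/eqP; rewrite zproj_eq0; apply/asboolP => S _ _; apply.
Qed.

(* Meaningful when [f] is additive and kills [X]; see [zliftE]. *)
Definition zlift (V W : zmodType) (X : set V) (f : V -> W) (u : zquot X) : W :=
  f (repr (u : Quotient.quot (gen_subgroup X))).

Lemma zliftE (V W : zmodType) (X : set V) (f : {additive V -> W}) v :
  X `<=` [set x | f x = 0] -> zlift f (@zproj V X v) = f v.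
Proof.
move=> fX; apply/eqP; rewrite -subr_eq0 -raddfB; apply/eqP.
have : repr (\pi_(Quotient.quot (gen_subgroup X)) v)%qT - v \in gen_subgroup X.
  by rewrite Quotient.idealrBE reprK.
rewrite unfold_in => /asboolP Sv; apply: (Sv [set x | f x = 0]) => /=.
- exact: raddf0.
- by move=> x y /= fx fy; rewrite raddfB fx fy subr0.
- exact: fX.
Qed.

Lemma zlift_is_zmod_morphism (V W : zmodType) (X : set V)
    (f : {additive V -> W}) :
  X `<=` [set x | f x = 0] -> zmod_morphism (@zlift V W X f).
Proof.
move=> fX u v; rewrite -[u](reprK (qT := Quotient.quot (gen_subgroup X))).
rewrite -[v](reprK (qT := Quotient.quot (gen_subgroup X))).
by rewrite -/(@zproj V X _) -/(@zproj V X _) -raddfB !zliftE // raddfB.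
Qed.

(* The generator [x] of the free abelian group on {y | P y}; it is 0 when
   [x] does not satisfy [P], a case which never arises below. *)
Definition fgen (T : choiceType) (P : pred T) (x : T) : {freeg {y | P y}} :=
  oapp (fun u => << u >>) 0 (insub x).

(** * The exterior square of F^*, the pre-Bloch group and the Bloch group *)

Section Bloch.
Variable F : fieldType.

Definition nz2 : pred (F * F) := fun p => (p.1 != 0) && (p.2 != 0).

Definition tensor_rel : set {freeg {p | nz2 p}} :=
  [set v | exists a b c : F, [/\ a != 0, b != 0 & c != 0] /\
    (v = fgen nz2 (a * b, c) - fgen nz2 (a, c) - fgen nz2 (b, c) \/
     v = fgen nz2 (c, a * b) - fgen nz2 (c, a) - fgen nz2 (c, b))].

Definition tensor_units : zmodType := zquot tensor_rel.

Definition tens (a b : F) : tensor_units := zproj tensor_rel (fgen nz2 (a, b)).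

Definition wedge_rel : set tensor_units :=
  [set v | exists a b : F, [/\ a != 0, b != 0 & v = tens a b + tens b a]].

Definition wedge_units : zmodType := zquot wedge_rel.

Definition wdg (a b : F) : wedge_units := zproj wedge_rel (tens a b).

Definition not01 : pred F := fun x => (x != 0) && (x != 1).

Definition five_term_rel : set {freeg {x | not01 x}} :=
  [set v | exists x y : F, [/\ not01 x, not01 y, x != y &
    v = fgen not01 x - fgen not01 y + fgen not01 (y / x)
        - fgen not01 ((1 - x^-1) / (1 - y^-1)) + fgen not01 ((1 - x) / (1 - y))]].

Definition prebloch : zmodType := zquot five_term_rel.

Definition psym (x : F) : prebloch := zproj five_term_rel (fgen not01 x).

(* [fglift] needs a module as target: [zmodule] is an abelian group seen as a
   Z-module. *)
Definition delta_free : {freeg {x | not01 x}} -> wedge_units :=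
  fglift (fun z : {x | not01 x} => wdg (val z) (1 - val z) : zmodule wedge_units).

Lemma delta_free_is_zmod_morphism : zmod_morphism delta_free.
Proof.
move=> x y; exact: (@lift_is_additive int _ (zmodule wedge_units) _ x y).
Qed.

HB.instance Definition _ := GRing.isZmodMorphism.Build
  {freeg {x | not01 x}} wedge_units delta_free delta_free_is_zmod_morphism.

Definition delta : prebloch -> wedge_units := zlift delta_free.

Lemma wdgMl a b c : a != 0 -> b != 0 -> c != 0 ->
  wdg (a * b) c = wdg a c + wdg b c.
Proof.
move=> a0 b0 c0; rewrite /wdg -raddfD /tens -raddfD; congr (zproj _ _).
apply/eqP; rewrite -subr_eq0 -raddfB; apply/eqP/zproj_eq0_gen.
by exists a, b, c; split=> //; left; rewrite opprD addrA.
Qed.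

Lemma wdgMr a b c : a != 0 -> b != 0 -> c != 0 ->
  wdg c (a * b) = wdg c a + wdg c b.
Proof.
move=> a0 b0 c0; rewrite /wdg -raddfD /tens -raddfD; congr (zproj _ _).
apply/eqP; rewrite -subr_eq0 -raddfB; apply/eqP/zproj_eq0_gen.
by exists a, b, c; split=> //; right; rewrite opprD addrA.
Qed.

Lemma wdgC a b : a != 0 -> b != 0 -> wdg b a = - wdg a b.
Proof.
move=> a0 b0; apply/eqP; rewrite -addr_eq0 -raddfD; apply/eqP/zproj_eq0_gen.
by exists b, a.
Qed.

Lemma wdg1l a : a != 0 -> wdg 1 a = 0.
Proof.
move=> a0; apply: (@addrI _ (wdg 1 a)).
by rewrite -wdgMl ?oner_neq0 // mulr1 addr0.
Qed.

Lemma wdgVl a b : a != 0 -> b != 0 -> wdg a^-1 b = - wdg a b.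
Proof.
move=> a0 b0; apply/eqP; rewrite -addr_eq0 -wdgMl ?invr_neq0 //.
by rewrite mulVf // wdg1l.
Qed.

Lemma wdgVr a b : a != 0 -> b != 0 -> wdg a b^-1 = - wdg a b.
Proof. by move=> a0 b0; rewrite wdgC ?invr_neq0 // wdgVl // -wdgC. Qed.

Lemma delta_fgen x : not01 x -> delta_free (fgen not01 x) = wdg x (1 - x).
Proof.
move=> x01; rewrite /fgen insubT /= /delta_free liftU.
by rewrite scale1r.
Qed.

Lemma delta_five_term : five_term_rel `<=` [set v | delta_free v = 0].
Proof.
move=> _ [x [y [x01 y01 xy ->]]] /=.
have [x0 x1] := andP x01; have [y0 y1] := andP y01.
have X0 : 1 - x != 0 by rewrite subr_eq0 eq_sym.
have Y0 : 1 - y != 0 by rewrite subr_eq0 eq_sym.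
have D0 : x - y != 0 by rewrite subr_eq0.
have x'0 : x - 1 != 0 by rewrite subr_eq0.
have y'0 : y - 1 != 0 by rewrite subr_eq0.
pose s := y / x; pose v := (1 - x) / (1 - y).
have s0 : s != 0 by rewrite mulf_neq0 ?invr_eq0.
have v0 : v != 0 by rewrite mulf_neq0 ?invr_eq0.
have -> : (1 - x^-1) / (1 - y^-1) = s * v.
  by rewrite /s /v; field; rewrite x0 y0 Y0 y'0.
rewrite -/s -/v.
have Es : 1 - s = (x - y) / x by rewrite /s; field.
have Ev : 1 - v = (x - y) / (1 - y) by rewrite /v; field.
have Eu : 1 - s * v = (x - y) / x / (1 - y).
  by rewrite /s /v; field; rewrite x0 Y0.
have n01 z : z != 0 -> 1 - z != 0 -> not01 z.
  by rewrite subr_eq0 (eq_sym 1) /not01 => -> ->.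
rewrite !(raddfB delta_free, raddfD delta_free) /= !delta_fgen //; first last.
- by apply: n01; rewrite ?Es ?mulf_neq0 ?invr_eq0.
- by apply: n01; rewrite ?Eu ?mulf_neq0 ?invr_eq0.
- by apply: n01; rewrite ?Ev ?mulf_neq0 ?invr_eq0.
rewrite Es Ev Eu (wdgMl s0 v0) ?mulf_neq0 ?invr_eq0 //.
have inv0 (z : F) : z != 0 -> z^-1 != 0 by rewrite invr_eq0.
have Dx0 : (x - y) / x != 0 by rewrite mulf_neq0 ?inv0.
rewrite !(wdgMr Dx0 (inv0 _ Y0)) // !(wdgMr D0 (inv0 _ x0)) //.
rewrite !(wdgMr D0 (inv0 _ Y0)) // !(@wdgVr _ (1 - y)) // !(@wdgVr _ x) //.
have cancel (U : zmodType) (P a b c d e f : U) :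
    P + (a - b) - (a - b - c + (d - e - f)) + (d - f) = P + c + e.
  rewrite [d - e - f]addrAC; move: (a - b) (d - f) => t r.
  rewrite opprD !opprB -!addrA; congr (P + _).
  by rewrite addNr addr0 addrCA addNKr.
rewrite cancel (wdgMl y0 (inv0 _ x0)) // (wdgMl X0 (inv0 _ Y0)) //.
rewrite !wdgVl // (wdgC x0 X0) (wdgC x0 Y0) opprK.
by rewrite subrKA [- _ + _]addrC -[X in _ + X]opprB subrr.
Qed.

Lemma delta_is_zmod_morphism : zmod_morphism delta.
Proof. exact: (@zlift_is_zmod_morphism _ _ _ delta_free delta_five_term). Qed.

HB.instance Definition _ :=
  GRing.isZmodMorphism.Build prebloch wedge_units delta delta_is_zmod_morphism.

Lemma delta_psym x : not01 x -> delta (psym x) = wdg x (1 - x).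
Proof.
move=> x01; rewrite /delta /psym (@zliftE _ _ _ delta_free) /=.
  exact: delta_fgen.
exact: delta_five_term.
Qed.

Definition bloch_group : set prebloch := [set u | delta u = 0].

End Bloch.

Arguments bloch_group F u : clear implicits.

Section Hyperbolic.
Variable R : realType.
Local Notation C := R[i].
Local Notation vec := 'cV[C]_3.

Definition hermJ : 'M[C]_3 := \matrix_(i < 3, j < 3) (i + j == 2)%N%:R.

Definition herm (z w : vec) : C := ((map_mx Num.conj w)^T *m hermJ *m z) 0 0.

(* Points of the projective plane are the lines of C^3. *)
Definition CP2 := {L : {vspace vec} | \dim L == 1%N}.

HB.instance Definition _ := Choice.on CP2.

Definition line (p : CP2) : {vspace vec} := val p.

(* The quotient topology of [C^3 \ {0}]: the cone over an open set is open. *)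
Definition CP2_open : set (set CP2) := fun O =>
  open ([set v | v != 0 /\ exists2 p : CP2, O p & line p = <[v]>%VS]
        : set 'cV[C^o]_3).

Lemma CP2_openT : CP2_open [set: CP2].
Proof.
have : open (~` [set (0 : 'cV[C^o]_3)]).
  rewrite openC; apply: accessible_closed_set1.
  exact/hausdorff_accessible/norm_hausdorff.
rewrite /CP2_open; congr open; apply/seteqP; split=> v /=; last by case=> /eqP.
  move=> /eqP v0; split=> //.
  have dv : \dim <[v : vec]>%VS == 1%N by rewrite dim_vline v0.
  by exists (exist (fun L : {vspace vec} => \dim L == 1%N) _ dv).
Qed.

Lemma CP2_openI : setI_closed CP2_open.
Proof.
move=> O O' oO oO'; have := openI oO oO'; rewrite /CP2_open; congr open.
apply/seteqP; split=> v /=.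
  move=> [[v0 [p Op pv]] [_ [q Oq qv]]]; split=> //; exists p => //.
  by split=> //; suff -> : p = q by []; exact: val_inj (etrans pv (esym qv)).
by move=> [v0 [p [Op O'p] pv]]; split; split=> //; exists p.
Qed.

Lemma CP2_open_bigU (I : Type) (f : I -> set CP2) :
  (forall i, CP2_open (f i)) -> CP2_open (\bigcup_i f i).
Proof.
move=> of_; have := bigcup_open (D := setT) (fun i _ => of_ i).
rewrite /CP2_open; congr open; apply/seteqP; split=> v /=.
  by move=> [i _ [v0 [p fp pv]]]; split=> //; exists p => //; exists i.
by move=> [v0 [p [i _ fp] pv]]; exists i => //; split=> //; exists p.
Qed.

HB.instance Definition _ := isOpenTopological.Build CP2
  CP2_openT CP2_openI CP2_open_bigU.

Definition S3 : set CP2 :=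
  [set p | forall v, v \in line p -> herm v v = 0].

Definition HC2 : set CP2 :=
  [set p | forall v, v \in line p -> v != 0 -> herm v v < 0].

Definition U21 : set 'M[C]_3 := [set A | (map_mx Num.conj A)^T *m hermJ *m A = hermJ].

Definition represents (A : 'M[C]_3) (g : CP2 -> CP2) :=
  forall p : CP2, line (g p) = (linfun (mulmx A : vec -> vec) @: line p)%VS.

(* U(2,1) modulo scalars, as a group of transformations of the projective
   plane. *)
Definition PU21 : set (CP2 -> CP2) :=
  [set g | exists2 A, U21 A & represents A g].

Definition parabolic : set (CP2 -> CP2) :=
  [set g | [/\ PU21 g, ~ (exists2 p, HC2 p & g p = p) &
              exists! p, S3 p /\ g p = p]].

Definition unipotent (A : 'M[C]_3) := exists n, (A - 1) ^+ n = 0.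

Definition purely_parabolic : set (CP2 -> CP2) :=
  [set g | parabolic g /\ exists A, [/\ U21 A, unipotent A & represents A g]].

Definition C_circle (X : set CP2) :=
  exists W : {vspace vec}, [/\ \dim W = 2%N,
    X = S3 `&` [set p : CP2 | (line p <= W)%VS] &
    exists p q, [/\ X p, X q & p <> q]].

Definition generic (p : 'I_4 -> CP2) :=
  [/\ forall i, S3 (p i), injective p &
      forall i j k, i != j -> i != k -> j != k ->
        ~ exists X, [/\ C_circle X, X (p i), X (p j) & X (p k)]].

Definition hat (p : CP2) : vec := vpick (line p).

Definition polar (p q : CP2) : vec :=
  xget 0 [set c | [/\ c != 0, herm (hat p) c = 0 & herm (hat q) c = 0]].

(* [z_ij], where (i, j, k, l) has to be an even permutation of (0, 1, 2, 3) *)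
Definition cross_inv (p : 'I_4 -> CP2) (i j k l : 'I_4) : C :=
  let c := polar (p i) (p j) in
  (herm (hat (p l)) c * herm (hat (p k)) (hat (p i))) /
  (herm (hat (p k)) c * herm (hat (p l)) (hat (p i))).

Definition beta_tetra (p : 'I_4 -> CP2) : prebloch C :=
  let z (i j k l : nat) := psym (cross_inv p (inord i) (inord j) (inord k) (inord l)) in
  z 0 1 2 3 + z 1 0 3 2 + z 2 3 0 1 + z 3 2 1 0.

End Hyperbolic.

Section Topology.
Implicit Types T U : topologicalType.

(* [f] maps the open set [D] homeomorphically onto a relatively open subset
   of [E]. *)
Definition open_embedding T U (D : set T) (E : set U) (f : T -> U) :=
  [/\ set_inj D f, f @` D `<=` E, {within D, continuous f} &
      forall W, open W -> W `<=` D -> exists2 O, open O & f @` W = O `&` E].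

Definition covering_map T U (f : T -> U) :=
  continuous f /\ forall x, (exists y, f y = x) /\
    exists O, [/\ open O, O x & exists V : T -> set T, forall y, O (f y) ->
      [/\ open (V y), V y y, open_embedding (V y) setT f, f @` V y = O &
          forall y', O (f y') -> V y `&` V y' !=set0 -> V y = V y']].

Definition deck T U (f : T -> U) : set (T -> T) :=
  [set g | [/\ continuous g,
    exists h, [/\ continuous h, cancel g h & cancel h g] &
    forall y, f (g y) = f y]].

Definition simply_connected (R : realType) T :=
  (forall a b : T, exists f : R -> T,
     [/\ {within `[0, 1], continuous f}, f 0 = a & f 1 = b]) /\
  (forall f : R -> T, {within `[0, 1], continuous f} -> f 0 = f 1 ->
     exists H : R * R -> T, {within `[0, 1] `*` `[0, 1], continuous H} /\
       forall t : R, 0 <= t <= 1 ->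
         [/\ H (0, t) = f t, H (1, t) = f 0, H (t, 0) = f 0 & H (t, 1) = f 0]).

End Topology.

Inductive gen_group (T : Type) (X : set (T -> T)) : set (T -> T) :=
| gen_group_mem g : X g -> gen_group X g
| gen_group_id : gen_group X id
| gen_group_comp g h : gen_group X g -> gen_group X h -> gen_group X (g \o h)
| gen_group_inv g h : gen_group X g -> cancel g h -> cancel h g ->
    gen_group X h.

Section SphericalCR.
Variable R : realType.
Local Notation CP2 := (CP2 R).

Definition cr_atlas (M : topologicalType) := set (set M * (M -> CP2)).

Record spherical_cr (M : topologicalType) (A : cr_atlas M) : Prop := {
  cr_hausdorff : hausdorff_space M;
  cr_second_countable : @second_countable M;
  cr_connected : connected [set: M];
  cr_cover : forall x, exists2 c, A c & c.1 x;
  cr_chart : forall c, A c -> open c.1 /\ open_embedding c.1 (@S3 R) c.2;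
  cr_transition : forall c c' x, A c -> A c' -> c.1 x -> c'.1 x ->
    exists2 g, PU21 g & \forall y \near x, c'.2 y = g (c.2 y) }.

(* A universal covering of [M], with a developing map and the corresponding
   holonomy representation of the fundamental group of [M], which is seen as
   the group of deck transformations. *)
Record development (M : topologicalType) (A : cr_atlas M) := {
  dv_space : topologicalType;
  dv_proj : dv_space -> M;
  dv_map : dv_space -> CP2;
  dv_hol : (dv_space -> dv_space) -> (CP2 -> CP2);
  dv_covering : covering_map dv_proj;
  dv_simply_connected : simply_connected R dv_space;
  dv_local : forall c y, A c -> c.1 (dv_proj y) ->
    exists2 g, PU21 g & \forall z \near y, dv_map z = g (c.2 (dv_proj z));
  dv_hol_PU21 : forall f, deck dv_proj f -> PU21 (dv_hol f);
  dv_hol_comp : forall f h, deck dv_proj f -> deck dv_proj h ->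
    dv_hol (f \o h) = dv_hol f \o dv_hol h;
  dv_equivariant : forall f y, deck dv_proj f ->
    dv_map (f y) = dv_hol f (dv_map y) }.

Arguments dv_proj {M A} D y : rename.
Arguments dv_map {M A} D y : rename.
Arguments dv_hol {M A} D f p : rename.

Definition half_space : set 'rV[R]_3 := [set x | 0 <= x 0 0].

Definition bordered_chart (N : topologicalType) (U : set N) (f : N -> 'rV[R]_3) :=
  open U /\ open_embedding U half_space f.

Definition compact_3manifold_with_boundary (N : topologicalType) :=
  [/\ hausdorff_space N, @second_countable N, compact [set: N] &
      forall y, exists U f, U y /\ @bordered_chart N U f].

Definition boundary (N : topologicalType) : set N :=
  [set y | exists U f, [/\ U y, @bordered_chart N U f & f y 0 0 = 0]].

Definition simplex : set 'rV[R]_4 :=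
  [set x | (forall i, 0 <= x 0 i) /\ \sum_i x 0 i = 1].

Definition vertex (i : 'I_4) : 'rV[R]_4 := delta_mx 0 i.

Definition facet (i : 'I_4) : set 'rV[R]_4 := simplex `&` [set x | x 0 i = 0].

Definition ideal_simplex : set 'rV[R]_4 :=
  simplex `&` [set x | forall i, x <> vertex i].

(* The facet opposite to the vertex [i] of the tetrahedron [s] is glued to the
   facet opposite to the vertex [lab s i i] of [nbr s i], each vertex [j] != [i]
   being sent to the vertex [lab s i j]. The vertices of all tetrahedra are
   ordered consistently with an orientation exactly when each [lab s i] is odd. *)
Record gluing (k : nat) := {
  nbr : 'I_k -> 'I_4 -> 'I_k;
  lab : 'I_k -> 'I_4 -> 'S_4;
  nbrK : forall s i, nbr (nbr s i) (lab s i i) = s;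
  labK : forall s i, lab (nbr s i) (lab s i i) = ((lab s i)^-1)%g;
  gluing_neq : forall s i, (nbr s i, lab s i i) <> (s, i);
  gluing_oriented : forall s i, odd_perm (lab s i) }.

Definition facet_map k (G : gluing k) (s : 'I_k) (i : 'I_4) (x : 'rV[R]_4) :
  'rV[R]_4 := \row_j x 0 (((lab G s i)^-1)%g j).

Inductive glued k (G : gluing k) :
  'I_k * 'rV[R]_4 -> 'I_k * 'rV[R]_4 -> Prop :=
| glued_facet s i x : facet i x -> glued G (s, x) (nbr G s i, facet_map G s i x)
| glued_refl a : glued G a a
| glued_sym a b : glued G a b -> glued G b a
| glued_trans a b c : glued G a b -> glued G b c -> glued G a c.

(* [M] is the interior of [tr_N] and [tr_space] is the space obtained from
   [tr_N] by collapsing each boundary component to a point; the last four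
   fields say that [tr_space] is the quotient of [k] copies of the simplex by
   the gluing [tr_glue], the vertices being the collapsed points. *)
Record ideal_triangulation (M : topologicalType) (k : nat) := {
  tr_N : topologicalType;
  tr_incl : M -> tr_N;
  tr_space : topologicalType;
  tr_collapse : tr_N -> tr_space;
  tr_simplex : 'I_k -> 'rV[R]_4 -> tr_space;
  tr_glue : gluing k;
  tr_N_manifold : compact_3manifold_with_boundary tr_N;
  tr_incl_embedding : open_embedding setT setT tr_incl;
  tr_incl_interior : range tr_incl = ~` @boundary tr_N;
  tr_collapse_surj : forall y, exists a, tr_collapse a = y;
  tr_collapse_open : forall O, open O <-> open (tr_collapse @^-1` O);
  tr_collapse_eq : forall a b, tr_collapse a = tr_collapse b <->
    a = b \/ [/\ boundary a, boundary b & connected_component (@boundary tr_N) a b];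
  tr_simplex_surj : forall y, exists s x, simplex x /\ tr_simplex s x = y;
  tr_simplex_open : forall O, open O <-> forall s, exists2 W, open W &
    simplex `&` tr_simplex s @^-1` O = simplex `&` W;
  tr_simplex_eq : forall s x t y, simplex x -> simplex y ->
    (tr_simplex s x = tr_simplex t y <-> glued tr_glue (s, x) (t, y));
  tr_vertices : forall y, (exists s i, tr_simplex s (vertex i) = y) <->
    exists2 b, boundary b & tr_collapse b = y }.

Arguments tr_incl {M k} K x : rename.
Arguments tr_collapse {M k} K a : rename.
Arguments tr_simplex {M k} K s x : rename.

(* [ct_lift s] is one chosen lift of the [s]-th tetrahedron, deprived of its
   ideal vertices, to the universal covering; the other lifts are its
   translates by deck transformations. [ct_dev s] is the tetrahedron developed
   in [S3], together with its vertices. *)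
Record cr_triangulation (M : topologicalType) (A : cr_atlas M)
    (D : development A) (k : nat) (K : ideal_triangulation M k) := {
  ct_lift : 'I_k -> 'rV[R]_4 -> dv_space D;
  ct_dev : 'I_k -> 'rV[R]_4 -> CP2;
  ct_side : 'I_k -> 'I_4 -> dv_space D -> dv_space D;
  ct_lift_continuous : forall s, {within ideal_simplex, continuous (ct_lift s)};
  ct_liftP : forall s x, ideal_simplex x ->
    tr_collapse K (tr_incl K (dv_proj D (ct_lift s x))) = tr_simplex K s x;
  ct_dev_continuous : forall s, {within simplex, continuous (ct_dev s)};
  ct_devE : forall s x, ideal_simplex x -> ct_dev s x = dv_map D (ct_lift s x);
  ct_generic : forall s, generic (fun i => ct_dev s (vertex i));
  ct_side_deck : forall s i, deck (dv_proj D) (ct_side s i);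
  ct_side_lift : forall s i x, facet i x -> ideal_simplex x ->
    ct_side s i (ct_lift s x) =
      ct_lift (nbr (tr_glue K) s i) (facet_map (tr_glue K) s i x);
  ct_side_dev : forall s i x, facet i x ->
    dv_hol D (ct_side s i) (ct_dev s x) =
      ct_dev (nbr (tr_glue K) s i) (facet_map (tr_glue K) s i x);
  ct_side_gen : forall f, deck (dv_proj D) f ->
    gen_group [set dv_hol D (ct_side si.1 si.2) | si in [set: 'I_k * 'I_4]]
      (dv_hol D f) }.

Section Invariant.
Variables (M : topologicalType) (A : cr_atlas M) (D : development A).
Variables (k : nat) (K : ideal_triangulation M k) (T : cr_triangulation D K).

Definition holonomy_group : set (CP2 -> CP2) :=
  [set dv_hol D f | f in deck (dv_proj D)].

Definition developed_vertices : set CP2 :=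
  [set p | exists g s i, holonomy_group g /\ p = g (ct_dev T s (vertex i))].

Definition purely_parabolic_boundary :=
  forall g p, holonomy_group g -> developed_vertices p -> g p = p ->
    purely_parabolic g \/ g = id.

Definition beta : prebloch R[i] :=
  \sum_(s < k) beta_tetra (fun i => ct_dev T s (vertex i)).

End Invariant.
End SphericalCR.

(* Main.v *)
(** Choose lifts v_i of the vertices of a generic tetrahedron and put
    a_ij = <v_j, v_i>, d_ijk = det (v_i, v_j, v_k). With
    X = a_ij d_ikl, Y = a_ik d_ijl, Z = a_il d_ijk one has z_ij = Y / Z, while the
    linear relation between four vectors of C^3 gives X - Y + Z = 0, whence
    z_ij /\ (1 - z_ij) = - (X /\ Y + Y /\ Z + Z /\ X). Therefore delta (beta Delta)
    is minus the sum, over the even permutations (i, j, k, l) of the vertices, of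
    (a_ij d_ikl) /\ (a_ik d_ijl). When this is expanded, the terms d /\ d cancel
    inside the tetrahedron, and every other term only involves the lifts of the
    vertices of one facet and changes sign with the orientation of this facet.
    So everything cancels between glued facets, provided that the lifts are
    compatible with the gluings up to roots of unity, which are invisible in the
    exterior square of C^*. Lifting the holonomy to SU(2,1), such a choice
    exists: a stabilizer of a vertex consists of unipotent matrices times cube
    roots of unity, and these fix the lifts of the vertex up to cube roots of
    unity. *)

Require Import Defs.
From mathcomp Require Import all_boot all_order all_algebra.
From mathcomp Require Import perm alt.
From mathcomp Require Import all_classical all_reals all_analysis.
From mathcomp Require Import complex ring.

Set Implicit Arguments.
Unset Strict Implicit.
Unset Printing Implicit Defensive.

Import Order.TTheory GRing.Theory Num.Theory.

Local Open Scope classical_set_scope.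
Local Open Scope ring_scope.

(** Each pair [x], [f x] is counted from its member of smaller rank. This works even with 2-torsion
    in [V], where a sum equal to its opposite need not vanish. *)
Lemma sum_alternating_involution (V : zmodType) (I : finType) (P : pred I)
    (f : I -> I) (F : I -> V) :
  involutive f -> (forall x, P (f x) = P x) -> (forall x, P x -> f x != x) ->
  (forall x, P x -> F (f x) = - F x) -> \sum_(x | P x) F x = 0.
Proof.
move=> fK Pf fx Ff; pose lt x := (enum_rank x < enum_rank (f x))%N.
rewrite (bigID lt) /= [X in _ + X](reindex_inj (inv_inj fK)) /=.
have -> : \sum_(x | P (f x) && ~~ lt (f x)) F (f x) =
          \sum_(x | P x && lt x) - F x.
  apply: eq_big => [x|x /andP[]]; last by rewrite Pf => /Ff.
  rewrite Pf /lt fK; case Px: (P x) => //=; rewrite -leqNgt leq_eqVlt.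
  by rewrite (inj_eq val_inj) (inj_eq enum_rank_inj) eq_sym (negPf (fx _ Px)).
by rewrite -big_split big1 //= => x _; rewrite subrr.
Qed.

(** * Roots of unity in the exterior square *)

Lemma closed_field_root (F : closedFieldType) n (x : F) :
  (0 < n)%N -> exists y, y ^+ n = x.
Proof.
move=> n0; have := solve_monicpoly (fun i => if i == 0%N then x else 0) n0.
case=> y yn; exists y; rewrite yn; case: n {yn} n0 => // n _.
by rewrite big_ord_recl /= mulr1 big1 ?addr0 // => i _; rewrite mul0r.
Qed.

Lemma deltaD (F : fieldType) (x y : prebloch F) :
  delta (x + y) = delta x + delta y.
Proof. exact: raddfD. Qed.

Lemma delta_sum_eq0 (F : fieldType) (I : finType) (b : I -> prebloch F)
    (w : I -> wedge_units F) :
  (forall i, delta (b i) = - w i) -> \sum_i w i = 0 -> delta (\sum_i b i) = 0.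
Proof.
by move=> bw w0; rewrite raddf_sum (eq_bigr _ (fun i _ => bw i)) sumrN w0 oppr0.
Qed.

Section RootsOfUnity.
Variable F : fieldType.
Hypothesis root_exists : forall n (x : F), (0 < n)%N -> exists y, y ^+ n = x.
Implicit Types x y u : F.

(* Equality up to a root of unity: such factors are invisible in the exterior
   square, since the units of an algebraically closed field are divisible. *)
Definition eqmu x y :=
  exists n u, [/\ (0 < n)%N, u ^+ n = 1 & x = u * y].

Lemma eqmu_refl x : eqmu x x.
Proof. by exists 1%N, 1; rewrite expr1 mul1r. Qed.

Lemma eqmuN x : eqmu (- x) x.
Proof. by exists 2, (-1); rewrite sqrrN expr1n mulN1r. Qed.

Lemma eqmu_sym x y : eqmu x y -> eqmu y x.
Proof.
move=> [n [u [n0 un ->]]]; have u0 : u != 0.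
  by apply/eqP => u0; move/eqP: un; rewrite u0 expr0n gtn_eqF // eq_sym oner_eq0.
by exists n, u^-1; split=> //; rewrite ?exprVn ?un ?invr1 // mulKf.
Qed.

Lemma eqmuM n u x : (0 < n)%N -> u ^+ n = 1 -> eqmu (u * x) x.
Proof. by exists n, u. Qed.

Lemma wdgX n x y : x != 0 -> y != 0 -> wdg (x ^+ n) y = wdg x y *+ n.
Proof.
move=> x0 y0; elim: n => [|n IH]; first by rewrite mulr0n wdg1l.
by rewrite exprS wdgMl ?expf_neq0 // IH mulrS.
Qed.

Lemma wdgXr n x y : x != 0 -> y != 0 -> wdg x (y ^+ n) = wdg x y *+ n.
Proof.
by move=> x0 y0; rewrite wdgC ?expf_neq0 // wdgX // wdgC // mulNrn opprK.
Qed.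

(** Writing [x = y ^+ n], the exponent moves across the wedge:
    [wdg u x = wdg (u ^+ n) y = wdg 1 y = 0]. *)
Lemma wdg_root_of_unity n u x :
  (0 < n)%N -> u ^+ n = 1 -> x != 0 -> wdg u x = 0.
Proof.
move=> n0 un x0; have [y yn] := root_exists x n0.
have y0 : y != 0 by apply: contraNneq x0 => y0; rewrite -yn y0 expr0n gtn_eqF.
have u0 : u != 0.
  by apply/eqP => u0; move/eqP: un; rewrite u0 expr0n gtn_eqF // eq_sym oner_eq0.
by rewrite -yn wdgXr // -wdgX // un wdg1l.
Qed.

(** Antisymmetry only gives [wdg y y *+ 2 = 0]; for [x = y ^+ 2] this suffices, as [wdg x x] is four
    times [wdg y y]. *)
Lemma wdgxx x : x != 0 -> wdg x x = 0.
Proof.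
move=> x0; have [y yx] := root_exists x (ltn0Sn 1).
have y0 : y != 0 by apply: contraNneq x0 => y0; rewrite -yx y0 expr0n.
have yy : wdg y y *+ 2 = 0 by rewrite mulr2n {2}(wdgC y0 y0) subrr.
by rewrite -yx wdgX ?expf_neq0 // wdgXr // yy mul0rn.
Qed.

Lemma eqmu_wdg x x' y y' : x != 0 -> y != 0 -> eqmu x x' -> eqmu y y' ->
  wdg x y = wdg x' y'.
Proof.
move=> hx hy [n [u [n0 un xE]]] [m [v [m0 vm yE]]]; move: hx hy.
rewrite {x}xE {y}yE !mulf_eq0 !negb_or => /andP[u0 x0] /andP[v0 y0].
rewrite wdgMl ?mulf_neq0 // (wdg_root_of_unity n0 un) ?mulf_neq0 // add0r.
by rewrite wdgMr // [wdg _ v]wdgC // (wdg_root_of_unity m0 vm) // oppr0 add0r.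
Qed.

Lemma wdg_ratio x y z : x != 0 -> y != 0 -> z != 0 ->
  wdg (y / z) (- x / z) = - (wdg x y + wdg y z + wdg z x).
Proof.
move=> x0 y0 z0.
have xz0 : x / z != 0 by rewrite mulf_neq0 ?invr_eq0.
rewrite mulNr (@eqmu_wdg _ (y / z) _ (x / z)) ?oppr_eq0 ?mulf_neq0 ?invr_eq0 //;
  [|exact: eqmu_refl|exact: eqmuN].
rewrite wdgMl ?invr_eq0 // wdgVl // !wdgMr ?invr_eq0 // !wdgVr // wdgxx //.
by rewrite oppr0 addr0 (wdgC x0 y0) !opprD.
Qed.

(** The relation turns [1 - y / z] into [- x / z]. This is nonzero, so [y / z] differs from 1 and
    [wdg_ratio] applies. *)
Lemma delta_psym_ratio x y z : x != 0 -> y != 0 -> z != 0 -> x - y + z = 0 ->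
  delta (psym (y / z)) = - (wdg x y + wdg y z + wdg z x).
Proof.
move=> x0 y0 z0 xyz.
have y1 : 1 - y / z = - x / z.
  rewrite -(mulfV z0) -mulrBl; congr (_ / _); apply/eqP.
  by rewrite -subr_eq0 opprK -[X in _ == X]xyz; apply/eqP; ring.
rewrite delta_psym; first by rewrite y1 wdg_ratio.
rewrite /not01 mulf_neq0 ?invr_eq0 //=; apply: contraNneq x0 => yz1.
have /esym/eqP := y1; rewrite yz1 subrr mulf_eq0 oppr_eq0 invr_eq0.
by rewrite (negPf z0) orbF.
Qed.

End RootsOfUnity.

(** * Even permutations of four vertices *)

Definition o4 (i : nat) : 'I_4 := inord i.
Arguments o4 i%_N.

Lemma o4_eq i j : (i < 4)%N -> (j < 4)%N -> (o4 i == o4 j) = (i == j).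
Proof. by move=> i4 j4; rewrite -(inj_eq val_inj) /= !inordK. Qed.

(* The alternating group is the Klein four-group times the 3-cycles fixing 0. *)
Lemma sum_even4 (V : zmodType) (F : 'I_4 -> 'I_4 -> 'I_4 -> 'I_4 -> V) :
  let T i j k l :=
    F (o4 i) (o4 j) (o4 k) (o4 l) + F (o4 i) (o4 l) (o4 j) (o4 k) +
    F (o4 i) (o4 k) (o4 l) (o4 j) in
  \sum_(s : 'S_4 | ~~ odd_perm s) F (s (o4 0)) (s (o4 1)) (s (o4 2)) (s (o4 3)) =
  (T 0 1 2 3)%N + (T 1 0 3 2)%N + (T 2 3 0 1)%N + (T 3 2 1 0)%N.
Proof.
move=> T.
(* Products of two transpositions are even; they provide, with explicit values, the 3-cycle [c] and
   the double transpositions [u], [v], [w]. *)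
have two_swaps a b c d : (a < 4)%N -> (b < 4)%N -> (c < 4)%N -> (d < 4)%N ->
    a != b -> c != d -> exists2 s : 'S_4, ~~ odd_perm s & forall i, (i < 4)%N ->
      s (o4 i) = let j := if i == a then b else if i == b then a else i in
                 o4 (if j == c then d else if j == d then c else j).
  move=> a4 b4 c4 d4 ab cd.
  exists (tperm (o4 a) (o4 b) * tperm (o4 c) (o4 d))%g.
    by rewrite odd_permM !odd_tperm !o4_eq // ab cd.
  have E x y i : (x < 4)%N -> (y < 4)%N -> (i < 4)%N -> tperm (o4 x) (o4 y) (o4 i) =
      o4 (if i == x then y else if i == y then x else i).
    move=> x4 y4 i4; rewrite permE /= !o4_eq //.
    by case: eqP => // _; case: eqP.
  move=> i i4; rewrite permM E // E //.
  by case: eqP => // _; case: eqP.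
have [c ce cE] := two_swaps 1%N 3%N 1%N 2%N isT isT isT isT isT isT.
have [u ue uE] := two_swaps 0%N 1%N 2%N 3%N isT isT isT isT isT isT.
have [v ve vE] := two_swaps 0%N 2%N 1%N 3%N isT isT isT isT isT isT.
have [w we wE] := two_swaps 0%N 3%N 1%N 2%N isT isT isT isT isT isT.
pose r := [:: 1%g; u; v; w]; pose tc s := [:: s; (c * s)%g; (c * c * s)%g].
pose l := flatten (map tc r).
have ul : uniq l.
  apply: (@map_uniq _ _ (fun s : 'S_4 => (s (o4 0), s (o4 1)))).
  by rewrite /l /tc /= !permM !perm1 !cE //= !(uE, vE, wE) //= !inE !xpair_eqE !o4_eq.
have le : {subset l <= enum (Alt 'I_4)}.
  apply/allP; rewrite /l /tc /= !mem_enum !Alt_even !odd_permM !odd_perm1.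
  by rewrite (negPf ce) (negPf ue) (negPf ve) (negPf we).
(* Twelve distinct even permutations exhaust the alternating group, whose order is 4!/2. *)
have card12 : (size (enum (Alt 'I_4)) <= size l)%N.
  have := @card_Alt 'I_4; rewrite card_ord => /(_ isT) /eqP.
  by rewrite -[_`!]/(2 * 12)%N eqn_mul2l -cardE /= => /eqP ->.
have [eq_size mem_l] := uniq_min_size ul le card12.
have pl := uniq_perm ul (enum_uniq (Alt 'I_4)) mem_l.
rewrite (eq_bigl _ _ (fun s => esym (Alt_even s))) -big_enum /= -(perm_big _ pl).
rewrite /l /tc /= !big_cons big_nil /= addr0 !permM !perm1 !cE //= !(uE, vE, wE) //=.
by rewrite !addrA.
Qed.

(** * Hermitian algebra in C^3 *)

Lemma det_mx22 (S : comPzRingType) (M : 'M[S]_2) :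
  \det M = M 0 0 * M 1 1 - M 0 1 * M 1 0.
Proof.
rewrite (expand_det_row _ 0) !big_ord_recl big_ord0 /cofactor !det_mx11 !mxE addr0.
rewrite !expr0 expr1 mul1r mulN1r mulrN.
by congr (M _ _ * M _ _ - M _ _ * M _ _); apply/val_inj.
Qed.

Lemma det_mx33 (S : comPzRingType) (f : nat -> nat -> S) :
  \det (\matrix_(i < 3, j < 3) f i j) =
    f 0%N 0%N * (f 1%N 1%N * f 2%N 2%N - f 2%N 1%N * f 1%N 2%N)
    - f 1%N 0%N * (f 0%N 1%N * f 2%N 2%N - f 2%N 1%N * f 0%N 2%N)
    + f 2%N 0%N * (f 0%N 1%N * f 1%N 2%N - f 1%N 1%N * f 0%N 2%N).
Proof.
rewrite (expand_det_col _ 0) !big_ord_recl big_ord0 /cofactor.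
by rewrite !det_mx22 !mxE /= /bump /=; ring.
Qed.

Section HermitianAlgebra.
Variable R : realType.
Local Notation C := R[i].
Local Notation vec := 'cV[C]_3.
Implicit Types (u v w x y c : vec) (A : 'M[C]_3) (p q : CP2 R).

Lemma hermE u v : herm u v =
  (v 2 0)^* * u 0 0 + (v 1 0)^* * u 1 0 + (v 0 0)^* * u 2 0.
Proof.
rewrite /herm !mxE !big_ord_recl big_ord0 !mxE !big_ord_recl !big_ord0 !mxE /=.
rewrite !(mulr0, mulr1, addr0, add0r) addrA.
by congr (_^* * _ + _^* * _ + _^* * _);
  [congr (v _ _)|congr (v _ _)|congr (u _ _)|congr (u _ _)]; apply/val_inj.
Qed.

Definition cols3 u v w : 'M[C]_3 := \matrix_(i, j) (nth 0 [:: u; v; w] j) i 0.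

Definition det3 u v w : C := \det (cols3 u v w).

Lemma det3E u v w : det3 u v w =
  u 0 0 * (v 1 0 * w 2 0 - v 2 0 * w 1 0) - u 1 0 * (v 0 0 * w 2 0 - v 2 0 * w 0 0)
  + u 2 0 * (v 0 0 * w 1 0 - v 1 0 * w 0 0).
Proof.
have coord x : exists f : nat -> C, forall i, x i 0 = f i.
  by exists (fun k => x (inord k) 0) => i; rewrite inord_val.
have [fu Eu] := coord u; have [fv Ev] := coord v; have [fw Ew] := coord w.
have E : cols3 u v w = \matrix_(i, j) nth 0 [:: fu i; fv i; fw i] j.
  by apply/matrixP => i [[|[|[|//]]] hj]; rewrite !mxE /= ?Eu ?Ev ?Ew.
rewrite /det3 E !Eu !Ev !Ew.
rewrite (det_mx33 (fun i j => nth 0 [:: fu i; fv i; fw i] j)) /=.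
ring.
Qed.

Lemma det3_mul A u v w : det3 (A *m u) (A *m v) (A *m w) = \det A * det3 u v w.
Proof.
rewrite /det3 -det_mulmx; congr (\det _); apply/matrixP => i j; rewrite !mxE.
by case: j => [[|[|[|//]]] ?] /=; rewrite !mxE; apply: eq_bigr => k _; rewrite !mxE.
Qed.

(* Apply [herm _ c] to the linear relation between four vectors of C^3. *)
Lemma herm_det3 c u v w x : herm u c * det3 v w x - herm v c * det3 u w x +
  herm w c * det3 u v x - herm x c * det3 u v w = 0.
Proof. by rewrite !hermE !det3E; ring. Qed.

(* The determinant of the Gram matrix; the sign is [\det hermJ]. *)
Lemma det3_gram u v w : det3 u v w * (det3 u v w)^* =
  - (herm u u * (herm v v * herm w w - herm v w * herm w v)
     - herm u v * (herm v u * herm w w - herm v w * herm w u)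
     + herm u w * (herm v u * herm w v - herm v v * herm w u)).
Proof.
by rewrite !hermE !det3E !(rmorphB, rmorphD, rmorphM) /=; ring.
Qed.

Lemma hermZ a b u v : herm (a *: u) (b *: v) = a * b^* * herm u v.
Proof. by rewrite !hermE !mxE !rmorphM /=; ring. Qed.

Lemma hermC u v : herm v u = (herm u v)^*.
Proof. by rewrite !hermE !(rmorphD, rmorphM) /= !conjCK; ring. Qed.

Lemma det3_eq0 u v w : det3 u v w = 0 ->
  exists a b c : C, [|| a != 0, b != 0 | c != 0] /\ a *: u + b *: v + c *: w = 0.
Proof.
move=> /eqP; rewrite /det3 -det_tr => /det0P[r r0 rM].
exists (r 0 0), (r 0 1), (r 0 2); split.
  apply: contraNT r0; rewrite !negb_or !negbK => /and3P[/eqP r0 /eqP r1 /eqP r2].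
  apply/eqP/matrixP => i j; rewrite (ord1 i) mxE.
  case: j => [[|[|[|//]]] hj]; [rewrite -r0|rewrite -r1|rewrite -r2];
    by congr (r _ _); apply/val_inj.
apply/matrixP => i j; move/matrixP/(_ 0 i): rM.
rewrite !mxE (ord1 j) !big_ord_recl big_ord0 !mxE /= addr0 addrA.
by move=> <-; congr (r _ _ * _ + r _ _ * _ + r _ _ * _); apply/val_inj.
Qed.

Lemma herm_U21 A u v : U21 A -> herm (A *m u) (A *m v) = herm u v.
Proof.
move=> UA; rewrite /herm map_mxM trmx_mul -!mulmxA; congr ((_ *m _) 0 0).
by rewrite !mulmxA UA.
Qed.

Lemma det3Z (a b c : C) u v w :
  det3 (a *: u) (b *: v) (c *: w) = a * b * c * det3 u v w.
Proof. by rewrite !det3E !mxE; ring. Qed.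

Lemma det3_swap u v w : det3 u w v = - det3 u v w.
Proof. by rewrite !det3E; ring. Qed.

Lemma det3_rot u v w : det3 v w u = det3 u v w.
Proof. by rewrite !det3E; ring. Qed.

Lemma herm_eq0 c : (forall x, herm x c = 0) -> c = 0.
Proof.
move=> c0; apply/matrixP => i j; rewrite (ord1 j) mxE; apply/eqP.
rewrite -conjC_eq0; apply/eqP.
(* [hermJ] pairs the coordinates [i] and [2 - i], hence the reversed basis vector. *)
have := c0 (delta_mx (rev_ord i) 0); rewrite hermE !mxE.
by case: i => [[|[|[|//]]] hi]; rewrite /= !(mulr0, mulr1, addr0, add0r) => <-;
  congr ((c _ _)^*); apply/val_inj.
Qed.

(** The linear form [det3 u v _] kills [u] and [v]. It equals [herm _ c] for [c] the conjugate of
    the cross product with reversed coordinates, and its value at [w] shows that [c] is nonzero. *)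
Lemma exists_polar u v w : det3 u v w != 0 ->
  exists c, [/\ c != 0, herm u c = 0 & herm v c = 0].
Proof.
pose m : vec := \col_i [:: u 0 0 * v 1 0 - u 1 0 * v 0 0;
   u 2 0 * v 0 0 - u 0 0 * v 2 0; u 1 0 * v 2 0 - u 2 0 * v 1 0]`_i.
pose c : vec := map_mx Num.conj m.
have E x : herm x c = det3 u v x.
  by rewrite hermE !mxE /= !conjCK det3E; ring.
move=> d0; exists c; split; rewrite ?E.
- apply: contraNneq d0 => c0; rewrite -E hermE c0 !mxE !rmorph0; apply/eqP; ring.
- by rewrite det3E; ring.
- by rewrite det3E; ring.
Qed.

End HermitianAlgebra.

(** * Lifts of points, cross-ratios as quotients of determinants, and genericity *)

Section GenericTetrahedra.
Variable R : realType.
Local Notation C := R[i].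
Local Notation vec := 'cV[C]_3.
Local Notation CP2 := (CP2 R).
Implicit Types (u v w x y c : vec) (A : 'M[C]_3) (p q : CP2).

Definition lifts v p := v != 0 /\ v \in line p.

Lemma lifts_line v p : lifts v p -> line p = <[v]>%VS.
Proof.
move=> [v0 vp]; apply/esym/eqP; rewrite eqEdim -memvE vp dim_vline v0.
by rewrite (eqP (valP p)).
Qed.

Lemma line_lifts v p : v != 0 -> line p = <[v]>%VS -> lifts v p.
Proof. by move=> v0 pv; rewrite /lifts pv memv_line. Qed.

Lemma line_inj p q : line p = line q -> p = q.
Proof. exact: val_inj. Qed.

Lemma lifts_exists v : v != 0 -> exists p, lifts v p.
Proof.
move=> v0; have dv : \dim <[v]>%VS == 1%N by rewrite dim_vline v0.
exists (exist (fun L : {vspace vec} => \dim L == 1%N) _ dv).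
by rewrite /lifts v0 memv_line.
Qed.

Lemma lifts_hat p : lifts (hat p) p.
Proof.
split; last exact: memv_pick.
rewrite vpick0; apply: contraL (valP p) => /eqP p0.
by rewrite [val p]p0 dimv0.
Qed.

Lemma lifts_hatE v p : lifts v p -> exists2 t, t != 0 & hat p = t *: v.
Proof.
move=> vp; have [h0] := lifts_hat p; rewrite (lifts_line vp) => /vlineP[t ht].
by exists t => //; apply: contraNneq h0 => t0; rewrite ht t0 scale0r.
Qed.

Lemma lifts_S3 v p : lifts v p -> S3 p -> herm v v = 0.
Proof. by move=> [_ vp]; apply. Qed.

(** The forms [herm _ c] and [det3 (v i) (v j) _] both kill [v i] and [v j], hence are proportional,
    so determinants replace the polar vector. The scalars between [hat] and the given lifts
    cancel. *)
Lemma cross_inv_lifts (p : 'I_4 -> CP2) (v : 'I_4 -> vec) i j k l :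
  (forall m, lifts (v m) (p m)) ->
  det3 (v i) (v j) (v k) != 0 -> det3 (v i) (v j) (v l) != 0 ->
  cross_inv p i j k l =
    (herm (v k) (v i) * det3 (v i) (v j) (v l)) /
    (herm (v l) (v i) * det3 (v i) (v j) (v k)).
Proof.
move=> vp dk dl; rewrite /cross_inv.
have [ti ti0 hi] := lifts_hatE (vp i); have [tj tj0 hj] := lifts_hatE (vp j).
have [tk tk0 hk] := lifts_hatE (vp k); have [tl tl0 hl] := lifts_hatE (vp l).
set c := polar _ _.
have hermZl t u w : herm (t *: u) w = t * herm u w.
  by rewrite -{1}[w]scale1r hermZ rmorph1 mulr1.
have [c0 ci cj] : [/\ c != 0, herm (v i) c = 0 & herm (v j) c = 0].
  have : [/\ c != 0, herm (hat (p i)) c = 0 & herm (hat (p j)) c = 0].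
    (* A polar vector exists, so [xget] does not return its default value 0. *)
    have [e [e0 ei ej]] := exists_polar dk.
    rewrite /c /polar; case: xgetP => [_ _ //|/(_ e) []].
    by rewrite /= hi hj !hermZl ei ej !mulr0.
  by rewrite hi hj !hermZl => -[-> /eqP + /eqP];
    rewrite !mulf_eq0 (negPf ti0) (negPf tj0) /= => /eqP-> /eqP->.
have cE x : herm (v k) c * det3 (v i) (v j) x = herm x c * det3 (v i) (v j) (v k).
  have := herm_det3 c (v i) (v j) (v k) x.
  by rewrite ci cj !mul0r subrr add0r => /eqP; rewrite subr_eq0 => /eqP.
have ck : herm (v k) c != 0.
  apply/eqP => ck; case/eqP: c0; apply: herm_eq0 => x; apply/eqP.
  by move: (cE x); rewrite ck mul0r => /esym/eqP; rewrite mulf_eq0 (negPf dk) orbF.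
have cl : herm (v l) c = herm (v k) c * det3 (v i) (v j) (v l) / det3 (v i) (v j) (v k).
  by rewrite cE mulfK.
rewrite hi hk hl !hermZ !hermZl cl.
(* In the degenerate case both sides are 0, by the convention [0^-1 = 0]. *)
have [->|li] := eqVneq (herm (v l) (v i)) 0.
  by rewrite !mulr0 mul0r !invr0 !mulr0.
have ti'0 : ti^* != 0 by rewrite conjC_eq0.
move: (herm (v k) c) ck (herm (v k) (v i)) (herm (v l) (v i)) li => hkc ck a b b0.
move: (det3 _ _ _) dk (det3 _ _ _) (ti^* ) ti'0 => d dk d' t t0.
by field; rewrite tk0 tl0 t0 dk ck b0.
Qed.

(** Dependent lifts would put the three points in the plane spanned by [v i] and [v j], hence on a
    common C-circle. *)
Lemma generic_det3 (p : 'I_4 -> CP2) (v : 'I_4 -> vec) i j k :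
  generic p -> (forall m, lifts (v m) (p m)) ->
  i != j -> i != k -> j != k -> det3 (v i) (v j) (v k) != 0.
Proof.
move=> [pS pinj pC] vp ij ik jk; apply/eqP => d0.
have S3v m : S3 (p m) by exact: pS.
have v0 m : v m != 0 by case: (vp m).
have indep m n : m != n -> v m \notin <[v n]>%VS.
  move=> mn; apply: contra mn => vmn; apply/eqP/pinj/line_inj.
  rewrite (lifts_line (vp n)); apply: lifts_line.
  by apply: line_lifts; rewrite ?v0 //; rewrite (lifts_line (vp m));
    apply/eqP; rewrite eqEdim -memvE vmn !dim_vline !v0.
apply: (pC i j k) => //.
pose W := <<[:: v i; v j]>>%VS.
have sub m : v m \in W -> (line (p m) <= W)%VS.
  by rewrite (lifts_line (vp m)) memvE.
have viW : v i \in W by rewrite memv_span ?inE ?eqxx.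
have vjW : v j \in W by rewrite memv_span ?inE ?eqxx ?orbT.
have vkW : v k \in W.
  have [a [b [c [abc /eqP]]]] := det3_eq0 d0.
  have [c0|c0] := eqVneq c 0; last first.
    rewrite addr_eq0 => /eqP vkE.
    rewrite -[v k](scalerK c0) -[c *: v k]opprK -vkE.
    by rewrite memvZ // memvN memvD // memvZ.
  rewrite c0 scale0r addr0 => /eqP ab0.
  have [a0|a0] := eqVneq a 0.
    move: ab0 abc; rewrite a0 c0 eqxx orbF scale0r add0r => /eqP.
    by rewrite scaler_eq0 (negPf (v0 j)) orbF => /eqP ->; rewrite eqxx.
  move/eqP: ab0; rewrite addr_eq0 => /eqP vi.
  case/negP: (indep i j ij); rewrite -[v i](scalerK a0) vi.
  by rewrite memvZ // memvN memvZ // memv_line.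
exists (@S3 R `&` [set q : CP2 | (line q <= W)%VS]); split.
- exists W; split=> //.
    apply/eqP; rewrite -[2%N]/(size [:: v i; v j]) -/(free _).
    by rewrite free_cons span_seq1 (indep _ _ ij) seq1_free v0.
  exists (p i), (p j); split; [by split=> //; exact: sub..|].
  by move/pinj/eqP; rewrite (negPf ij).
- by split=> //; exact: sub.
- by split=> //; exact: sub.
- by split=> //; exact: sub.
Qed.

(** If [herm u v = 0], every term of the Gram determinant of three null vectors vanishes, and with
    it the squared modulus of [det3 u v w]. *)
Lemma null_herm_neq0 u v w : herm u u = 0 -> herm v v = 0 -> herm w w = 0 ->
  det3 u v w != 0 -> herm u v != 0.
Proof.
move=> u0 v0 w0; apply: contra => /eqP uv; rewrite -[_ == 0]orbb.
rewrite -[X in _ || X]conjC_eq0 -mulf_eq0 det3_gram.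
have vu : herm v u = 0 by rewrite hermC uv rmorph0.
move: (@herm R) u0 v0 w0 uv vu => g -> -> -> -> ->.
by rewrite !(mul0r, mulr0, subrr, addr0, oppr0).
Qed.

End GenericTetrahedra.

(** * The sum over the tetrahedra *)

Section TetrahedronSum.
(* Otherwise failing unifications unfold the quotient groups. *)
#[local] Opaque wedge_units prebloch wdg psym delta cross_inv inord.
Variable R : realType.
Local Notation C := R[i].
Local Notation vec := 'cV[C]_3.
Let rootC n (x : C) : (0 < n)%N -> exists y, y ^+ n = x.
Proof. exact: closed_field_root. Qed.

Variables (p : 'I_4 -> CP2 R) (v : 'I_4 -> vec).
Hypothesis p_generic : generic p.
Hypothesis v_lifts : forall m, lifts (v m) (p m).

Definition ecoord (i j : 'I_4) : C := herm (v j) (v i).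
Definition fcoord (i j k : 'I_4) : C := det3 (v i) (v j) (v k).

Lemma fcoord_neq0 i j k : i != j -> i != k -> j != k -> fcoord i j k != 0.
Proof. exact: (generic_det3 p_generic). Qed.

Lemma ecoord_neq0 i j k : i != j -> i != k -> j != k -> ecoord i j != 0.
Proof.
move=> ij ik jk; have null m : herm (v m) (v m) = 0.
  by apply: (lifts_S3 (v_lifts m)); case: p_generic.
by apply: (@null_herm_neq0 _ _ _ (v k)) => //; apply: fcoord_neq0; rewrite // eq_sym.
Qed.

Definition bterm (i j k l : 'I_4) :=
  wdg (ecoord i j * fcoord i k l) (ecoord i k * fcoord i j l).

(** Cyclic permutations of [j], [k], [l] turn [X /\ Y] into [Z /\ X] and [Y /\ Z] up to signs, which
    are roots of unity. *)
Lemma delta_cross_inv i j k l : uniq [:: i; j; k; l] ->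
  delta (psym (cross_inv p i j k l)) =
  - (bterm i j k l + bterm i l j k + bterm i k l j).
Proof.
rewrite /= !inE !negb_or => /and4P[/and3P[ij ik il] /andP[jk jl] kl _].
have ji : j != i by rewrite eq_sym.
have ki : k != i by rewrite eq_sym.
have li : l != i by rewrite eq_sym.
have lk : l != k by rewrite eq_sym.
have kj : k != j by rewrite eq_sym.
have lj : l != j by rewrite eq_sym.
(* The linear relation is paired with [v i] itself, whose nullity removes one of the four terms. *)
have xyz : ecoord i j * fcoord i k l - ecoord i k * fcoord i j l
           + ecoord i l * fcoord i j k = 0.
  have null : herm (v i) (v i) = 0.
    by apply: (lifts_S3 (v_lifts i)); case: p_generic.
  have := herm_det3 (v i) (v i) (v j) (v k) (v l).
  rewrite null mul0r sub0r => /(congr1 -%R).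
  by rewrite oppr0 !opprD !opprK.
have E m n : fcoord i n m = - fcoord i m n by exact: det3_swap.
have zE : cross_inv p i j k l =
    (ecoord i k * fcoord i j l) / (ecoord i l * fcoord i j k).
  by apply: cross_inv_lifts => //; apply: fcoord_neq0.
have := ecoord_neq0 il ik lk; have := ecoord_neq0 ik ij kj.
have := ecoord_neq0 ij ik jk; have := fcoord_neq0 ij ik jk.
have := fcoord_neq0 ij il jl; have := fcoord_neq0 ik il kl.
move: xyz; rewrite {}zE /bterm (E j k) (E j l) (E k l).
move: (ecoord i j) (ecoord i k) (ecoord i l) => a b c.
move: (fcoord i k l) (fcoord i j l) (fcoord i j k) => f g h xyz f0 g0 h0 a0 b0 c0.
have [x0 y0 z0] : [/\ a * f != 0, b * g != 0 & c * h != 0].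
  by split; apply: mulf_neq0.
rewrite (delta_psym_ratio rootC x0 y0 z0 xyz) !mulrN; congr (- _).
rewrite addrAC; congr (_ + _ + _); apply: (eqmu_wdg rootC) => //;
  by [exact: eqmu_refl|apply: eqmu_sym; exact: eqmuN].
Qed.

Definition even_terms : wedge_units C :=
  \sum_(s : 'S_4 | ~~ odd_perm s) bterm (s (o4 0)) (s (o4 1)) (s (o4 2)) (s (o4 3)).

(** Each of the four cross-ratios yields three terms; together they run over the twelve even
    orderings of the vertices. *)
Lemma delta_beta_tetra : delta (beta_tetra p) = - even_terms.
Proof.
have -> : even_terms = _ := sum_even4 bterm.
rewrite /beta_tetra !deltaD -/(o4 0) -/(o4 1) -/(o4 2) -/(o4 3).
have opp4 (V : zmodType) (x y z w : V) : - (x + y + z + w) = - x - y - z - w.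
  by rewrite !opprD.
rewrite opp4; congr (_ + _ + _ + _); apply: delta_cross_inv;
  by rewrite /= !inE !o4_eq.
Qed.

End TetrahedronSum.

(** * Cancellation between glued facets, for abstract edge and face coordinates *)

Section GluedSum.
#[local] Opaque wedge_units wdg.
Variable R : realType.
Local Notation C := R[i].
Let rootC n (x : C) : (0 < n)%N -> exists y, y ^+ n = x.
Proof. exact: closed_field_root. Qed.

Variables (k : nat) (G : gluing k).
Variables (a : 'I_k -> 'I_4 -> 'I_4 -> C) (d : 'I_k -> 'I_4 -> 'I_4 -> 'I_4 -> C).
Hypothesis a_neq0 : forall s i j, i != j -> a s i j != 0.
Hypothesis d_neq0 : forall s i j l, i != j -> i != l -> j != l -> d s i j l != 0.
Hypothesis d_swap : forall s i j l, d s i l j = - d s i j l.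
Hypothesis d_rot : forall s i j l, d s j l i = d s i j l.
Hypothesis a_glue : forall s i x y, x != i -> y != i ->
  eqmu (a s x y) (a (nbr G s i) (lab G s i x) (lab G s i y)).
Hypothesis d_glue : forall s i x y z, x != i -> y != i -> z != i ->
  eqmu (d s x y z)
    (d (nbr G s i) (lab G s i x) (lab G s i y) (lab G s i z)).

Let t12 : 'S_4 := tperm (o4 1) (o4 2).

(* Cross the facet opposite to the vertex [x.2 m]; the transposition makes up
   for the orientation reversal. *)
Let cross m (x : 'I_k * 'S_4) : 'I_k * 'S_4 :=
  (nbr G x.1 (x.2 m), (t12 * x.2 * lab G x.1 (x.2 m))%g).

Let even (x : 'I_k * 'S_4) := ~~ odd_perm x.2.

Let t12E : [/\ t12 (o4 0) = o4 0, t12 (o4 1) = o4 2, t12 (o4 2) = o4 1 &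
  t12 (o4 3) = o4 3].
Proof.
by split; rewrite /t12; case: tpermP => //; move/(congr1 val); rewrite /= !inordK.
Qed.

Let cross_even m x : even (cross m x) = even x.
Proof.
rewrite /even /cross /= !odd_permM odd_tperm gluing_oriented.
by rewrite o4_eq //= addbT negbK.
Qed.

(** In the new ordering, position [m] holds the vertex opposite to the facet just crossed, so
    crossing there leads back. *)
Let crossK m : cancel (cross (t12 m)) (cross m).
Proof.
move=> [s q]; rewrite /cross /= !permM nbrK labK.
by rewrite !mulgA tperm2 mul1g mulgK.
Qed.

Let cross3_involutive : involutive (cross (o4 3)).
Proof. by have := crossK (o4 3); case: t12E => _ _ _ ->. Qed.

Let q_neq (q : 'S_4) i j : (i < 4)%N -> (j < 4)%N -> i != j ->
  q (o4 i) != q (o4 j).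
Proof. by move=> i4 j4; rewrite (inj_eq perm_inj) o4_eq. Qed.

(* Pairing of each facet with the facet it is glued to. *)
Lemma sum_edge_edge : \sum_(x | even x)
  wdg (a x.1 (x.2 (o4 0)) (x.2 (o4 1))) (a x.1 (x.2 (o4 0)) (x.2 (o4 2))) = 0.
Proof.
apply: (sum_alternating_involution cross3_involutive) => [x|x _|[s q] _].
- exact: cross_even.
(* A fixed point would be a facet glued to itself. *)
- apply/eqP => xx; apply: (@gluing_neq _ G x.1 (x.2 (o4 3))).
  move: (congr1 (fun y : 'I_k * 'S_4 => (y.1, y.2 (o4 3))) xx); case: t12E => _ _ _ t3.
  by rewrite /= !permM t3.
- case: t12E => t0 t1 t2 t3; rewrite /= !permM t0 t1 t2.
  (* The swap of positions 1 and 2 exchanges the two edges, which reverses the wedge. *)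
  rewrite -wdgC ?a_neq0 ?(inj_eq perm_inj) ?q_neq ?o4_eq //.
  by apply: esym; apply: (eqmu_wdg rootC); rewrite ?a_neq0 ?q_neq //;
    apply: a_glue; rewrite q_neq.
Qed.

(** The first sum involves the facet opposite to position 2, the second the facet opposite to
    position 1. Crossing at position 2 matches them, with the two factors of the wedge in opposite
    orders. *)
Lemma sum_edge_face :
  \sum_(x | even x) wdg (a x.1 (x.2 (o4 0)) (x.2 (o4 1)))
                        (d x.1 (x.2 (o4 0)) (x.2 (o4 1)) (x.2 (o4 3))) +
  \sum_(x | even x) wdg (d x.1 (x.2 (o4 0)) (x.2 (o4 2)) (x.2 (o4 3)))
                        (a x.1 (x.2 (o4 0)) (x.2 (o4 2))) = 0.
Proof.
case: t12E => t0 t1 t2 t3.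
have inj2 : injective (cross (o4 2)).
  by rewrite -t1; exact: can_inj (crossK _).
rewrite [X in _ + X](reindex_inj inj2) /= (eq_bigl _ _ (cross_even (o4 2))).
rewrite -big_split big1 //= => -[s q] _; apply/eqP.
rewrite /= !permM t0 t2 t3 addr_eq0; apply/eqP.
rewrite -wdgC ?a_neq0 ?d_neq0 ?(inj_eq perm_inj) ?q_neq ?o4_eq //.
by apply: (eqmu_wdg rootC); rewrite ?a_neq0 ?d_neq0 ?q_neq //;
  [apply: a_glue|apply: d_glue]; rewrite q_neq.
Qed.

(* Two facets of a tetrahedron share an edge; its two end points give opposite
   contributions. *)
Lemma sum_face_face : \sum_(x | even x)
  wdg (d x.1 (x.2 (o4 0)) (x.2 (o4 2)) (x.2 (o4 3)))
      (d x.1 (x.2 (o4 0)) (x.2 (o4 1)) (x.2 (o4 3))) = 0.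
Proof.
(* This even permutation exchanges the ends 0, 3 of the common edge, and also the two remaining
   vertices, hence the two facets. *)
pose t : 'S_4 := (tperm (o4 0) (o4 3) * t12)%g.
have [t0 t1 t2 t3] : [/\ t (o4 0) = o4 3, t (o4 1) = o4 2, t (o4 2) = o4 1 &
                            t (o4 3) = o4 0].
  case: t12E => e0 e1 e2 e3.
  by split; rewrite permM ?tpermL ?tpermR // [tperm _ (o4 3) _]tpermD ?o4_eq.
have tt : (t * t = 1)%g.
  apply/permP => i; rewrite permM perm1.
  have: i \in [seq o4 j | j <- iota 0 4].
    by apply/mapP; exists (val i); rewrite ?mem_iota ?add0n ?ltn_ord // /o4 inord_val.
  by rewrite /= !inE => /or4P[] /eqP ->; rewrite ?(t0, t1, t2, t3).
pose f (x : 'I_k * 'S_4) := (x.1, (t * x.2)%g).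
apply: (@sum_alternating_involution _ _ _ f) => [[s q]|[s q]|[s q] _|[s q] _].
- by rewrite /f /= mulgA tt mul1g.
- by rewrite /even /= /t !odd_permM !odd_tperm !o4_eq.
- apply/eqP => /(congr1 (fun x : 'I_k * 'S_4 => x.2 (o4 0))) /=.
  rewrite (permM t) t0 => /eqP.
  by apply/negP; rewrite q_neq.
- rewrite /= !(permM t) t0 t1 t2 t3 -wdgC ?d_neq0 ?q_neq //.
  apply: (eqmu_wdg rootC); rewrite ?d_neq0 ?q_neq //.
    by rewrite -d_rot -d_rot d_swap d_rot; exact: eqmuN.
  by rewrite -d_rot -d_rot d_swap d_rot; exact: eqmuN.
Qed.

(** Bilinearity splits each term into four wedges; the two mixed ones cancel against each other, the
    others separately. *)
Lemma sum_glued :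
  \sum_s \sum_(q : 'S_4 | ~~ odd_perm q)
    wdg (a s (q (o4 0)) (q (o4 1)) * d s (q (o4 0)) (q (o4 2)) (q (o4 3)))
        (a s (q (o4 0)) (q (o4 2)) * d s (q (o4 0)) (q (o4 1)) (q (o4 3))) = 0.
Proof.
rewrite pair_big_dep /= -/even.
have E : \sum_(x | even x)
  (wdg (a x.1 (x.2 (o4 0)) (x.2 (o4 1))) (a x.1 (x.2 (o4 0)) (x.2 (o4 2)))
  + (wdg (a x.1 (x.2 (o4 0)) (x.2 (o4 1)))
                        (d x.1 (x.2 (o4 0)) (x.2 (o4 1)) (x.2 (o4 3))) +
    wdg (d x.1 (x.2 (o4 0)) (x.2 (o4 2)) (x.2 (o4 3)))
                        (a x.1 (x.2 (o4 0)) (x.2 (o4 2))))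
  + wdg (d x.1 (x.2 (o4 0)) (x.2 (o4 2)) (x.2 (o4 3)))
      (d x.1 (x.2 (o4 0)) (x.2 (o4 1)) (x.2 (o4 3)))) = 0.
  by rewrite !big_split /= sum_edge_edge sum_edge_face sum_face_face !addr0.
rewrite -[RHS]E; apply: eq_bigr => -[s q] _ /=.
rewrite wdgMl ?mulf_neq0 ?a_neq0 ?d_neq0 ?q_neq // !wdgMr ?a_neq0 ?d_neq0 ?q_neq //.
by rewrite !addrA.
Qed.

End GluedSum.

(** * Equivariant lifts *)

Section SpecialLifts.
Variable R : realType.
Local Notation C := R[i].
Local Notation vec := 'cV[C]_3.
Local Notation CP2 := (CP2 R).
Implicit Types (u v w : vec) (A B N : 'M[C]_3) (p q : CP2) (g h : CP2 -> CP2).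

(* [A] induces [g] on the projective plane; for invertible [A] this is
   [represents A g]. *)
Definition acts A g := forall v p, lifts v p -> lifts (A *m v) (g p).

Lemma lifts_scale (c : C) v p : c != 0 -> lifts v p -> lifts (c *: v) p.
Proof.
by move=> c0 [v0 vp]; split; rewrite ?scaler_eq0 ?negb_or ?c0 ?v0 ?memvZ.
Qed.

Lemma lifts_collinear v w p : lifts v p -> lifts w p -> exists t, w = t *: v.
Proof.
by move=> /lifts_line vp [_]; rewrite vp => /vlineP.
Qed.

Lemma lifts_inj v p q : lifts v p -> lifts v q -> p = q.
Proof. by move=> /lifts_line vp /lifts_line vq; apply: line_inj; rewrite vp vq. Qed.

Lemma represents_acts A g : A \in unitmx -> represents A g -> acts A g.
Proof.
move=> uA rA v p vp; have [v0 _] := vp; apply: line_lifts.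
  by apply: contraNneq v0 => Av; rewrite -(mulKmx uA v) Av mulmx0.
by rewrite rA (lifts_line vp) limg_line lfunE.
Qed.

Lemma acts_id : acts 1%:M id.
Proof. by move=> v p; rewrite mul1mx. Qed.

Lemma acts_mul A B g h : acts A g -> acts B h -> acts (A *m B) (g \o h).
Proof. by move=> aA aB v p /aB /aA; rewrite mulmxA. Qed.

Lemma acts_inv A g h : A \in unitmx -> acts A g -> cancel h g -> acts (invmx A) h.
Proof.
move=> uA aA hK v p vp; have := aA _ _ (lifts_hat (h p)); rewrite hK => wp.
have [t vE] := lifts_collinear wp vp.
rewrite vE -scalemxAr mulKmx //; apply: lifts_scale (lifts_hat _).
by case: vp => + _; apply: contraNneq => t0; rewrite vE t0 scale0r.
Qed.

Lemma acts_scale (c : C) A g : c != 0 -> acts A g -> acts (c *: A) g.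
Proof. by move=> c0 aA v p /aA; rewrite -scalemxAl; exact: lifts_scale. Qed.

(** Basis vectors force [N] to be diagonal, and sums of two of them equate the diagonal entries. *)
Lemma scalar_of_eigen N :
  (forall v, v != 0 -> exists t, N *m v = t *: v) -> exists t, N = t%:M.
Proof.
move=> eN; pose e (i : 'I_3) : vec := delta_mx i 0.
have eE i j : e i j 0 = (j == i)%:R by rewrite mxE eqxx andbT.
have Ne i j : (N *m e i) j 0 = N j i by rewrite -colE mxE.
have e0 i : e i != 0.
  by apply/eqP => /matrixP/(_ i 0); rewrite eE eqxx mxE; apply/eqP/oner_neq0.
have off i j : i != j -> N i j = 0.
  have [t Nj] := eN _ (e0 j) => ij.
  by rewrite -Ne Nj mxE eE (negPf ij) mulr0.
have diag i j : N i i = N j j.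
  have [-> //|ij] := eqVneq i j.
  have : e i + e j != 0.
    apply/eqP => /matrixP/(_ i 0); rewrite mxE !eE eqxx (negPf ij) mxE addr0.
    by apply/eqP/oner_neq0.
  move=> /eN[t Nt].
  have K m : N m i + N m j = t * ((m == i)%:R + (m == j)%:R).
    have := congr1 (fun w : vec => w m 0) Nt.
    by rewrite mulmxDr [LHS]mxE !Ne => ->; rewrite [LHS]mxE [X in _ * X]mxE !eE.
  have := K i; have := K j; have ji : j != i by rewrite eq_sym.
  rewrite !eqxx (negPf ij) (negPf ji) (off _ _ ij) (off _ _ ji).
  by rewrite !addr0 !add0r => -> ->.
exists (N 0 0); apply/matrixP => i j; rewrite mxE.
by have [->|/off->] := eqVneq i j; rewrite ?mulr1n ?mulr0n.
Qed.

(** [invmx B *m A] preserves every line, hence is scalar. *)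
Lemma acts_proportional A B g : B \in unitmx -> acts A g -> acts B g ->
  exists t, A = t *: B.
Proof.
move=> uB aA aB; have [|t tE] := @scalar_of_eigen (invmx B *m A).
  move=> v v0; have [p vp] := lifts_exists v0.
  have [t tE] := lifts_collinear (aB _ _ vp) (aA _ _ vp).
  by exists t; rewrite -mulmxA tE -scalemxAr mulKmx.
by exists t; rewrite -(mulKVmx uB A) tE mul_mx_scalar.
Qed.

Lemma unipotent_eigen B v (t : C) :
  unipotent B -> v != 0 -> B *m v = t *: v -> t = 1.
Proof.
move=> [n Bn] v0 Bv.
have : (B - 1) ^+ n *m v = (t - 1) ^+ n *: v.
  elim: n {Bn} => [|n IH]; first by rewrite !expr0 mul1mx scale1r.
  rewrite !exprSr -mulmxA mulmxBl mul1mx Bv -{2}[v]scale1r -scalerBl.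
  by rewrite -scalemxAr IH scalerA mulrC.
rewrite Bn mul0mx => /esym/eqP; rewrite scaler_eq0 (negPf v0) orbF.
by rewrite expf_eq0 subr_eq0 => /andP[_ /eqP].
Qed.

Lemma unipotent_tr B : unipotent B -> unipotent B^T.
Proof.
move=> [n Bn]; exists n; rewrite -[1]trmx1 -linearB /=.
suff -> : (B - 1)^T ^+ n = ((B - 1) ^+ n)^T by rewrite Bn trmx0.
elim: n {Bn} => [|n IH]; first by rewrite !expr0 trmx1.
by rewrite exprSr IH exprS trmx_mul.
Qed.

(** All eigenvalues are 1, so the characteristic polynomial is the cube of [X - 1]. *)
Lemma unipotent_det B : unipotent B -> \det B = 1.
Proof.
move=> uB; have [r pE] := closed_field_poly_normal (char_poly B).
rewrite (monicP (char_poly_monic B)) scale1r in pE.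
have r1 z : z \in r -> z = 1.
  move=> zr; have : root (char_poly B) z by rewrite pE root_prod_XsubC.
  rewrite -eigenvalue_root_char => /eigenvalueP[w wB w0].
  (* [w] is a row eigenvector, hence the passage to transposes. *)
  apply: (@unipotent_eigen B^T w^T) (unipotent_tr uB) _ _.
    by rewrite trmx_eq0.
  by rewrite -trmx_mul wB linearZ.
have /all_pred1P rE : all (pred1 1) r by apply/allP => z /r1 ->; rewrite /= eqxx.
have sr : size r = 3%N.
  by have := size_char_poly B; rewrite pE size_prod_XsubC => -[].
have := char_poly_det B; rewrite -horner_coef0 pE rE sr /=.
rewrite !big_cons big_nil mulr1 !hornerM !hornerXsubC sub0r => E.
have -> : \det B = (-1) ^+ 3 * ((-1) ^+ 3 * \det B).
  by rewrite mulrA -exprD -signr_odd expr0 mul1r.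
by rewrite -E; ring.
Qed.

Lemma hermJ2 : hermJ R *m hermJ R = 1%:M.
Proof.
apply/matrixP => i j; rewrite !mxE !big_ord_recl big_ord0 !mxE /=.
by case: i => [[|[|[|//]]] hi]; case: j => [[|[|[|//]]] hj];
  rewrite /= !(mulr0, mul0r, mulr1, addr0, add0r).
Qed.

Lemma U21_unitmx A : U21 A -> A \in unitmx.
Proof.
move=> UA; have : (hermJ R *m (map_mx Num.conj A)^T *m hermJ R) *m A = 1%:M.
  by rewrite -!mulmxA [_^T *m _]mulmxA UA hermJ2.
by case/mulmx1_unit.
Qed.

Lemma U21_mul A B : U21 A -> U21 B -> U21 (A *m B).
Proof.
move=> UA UB; rewrite /U21 /= map_mxM trmx_mul -!mulmxA.
by rewrite (mulmxA (hermJ R)) (mulmxA _ _ B) (mulmxA _ (hermJ R)) UA mulmxA.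
Qed.

Lemma U21_inv A : U21 A -> U21 (invmx A).
Proof.
move=> UA; have uA := U21_unitmx UA; rewrite /U21 /= -[X in _ *m X *m _]UA.
rewrite -!mulmxA mulmxV // mulmx1 mulmxA -trmx_mul -map_mxM mulmxV //.
by rewrite map_mx1 trmx1 mul1mx.
Qed.

Lemma U21_scale (c : C) A : `|c| = 1 -> U21 A -> U21 (c *: A).
Proof.
move=> c1 UA; rewrite /U21 /=.
have -> : (map_mx Num.conj (c *: A))^T = c^* *: (map_mx Num.conj A)^T.
  by apply/matrixP => i j; rewrite !mxE rmorphM.
rewrite -!scalemxAl -scalemxAr UA.
by rewrite scalerA mulrC -normCK c1 expr1n scale1r.
Qed.

Lemma U21_norm_det A : U21 A -> `|\det A| = 1.
Proof.
move=> UA; have := congr1 (fun X => \det (X *m hermJ R)) UA.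
have dJ : \det (hermJ R) * \det (hermJ R) = 1 by rewrite -det_mulmx hermJ2 det1.
rewrite !det_mulmx dJ det_tr det_map_mx -!mulrA [\det (hermJ R) * (_ * _)]mulrCA.
rewrite dJ mulr1 mulrC -normCK => /eqP.
by rewrite pexpr_eq1 // => /eqP.
Qed.

(** A unitary matrix is divided by a cube root of its determinant; this root has modulus 1, so the
    form is still preserved. *)
Lemma PU21_special g : PU21 g -> exists A, [/\ U21 A, \det A = 1 & acts A g].
Proof.
move=> [A UA rA]; pose c := (3.-root (\det A))^-1.
have dA1 := U21_norm_det UA.
have dA0 : \det A != 0 by rewrite -normr_eq0 dA1 oner_neq0.
have c3 : c ^+ 3 = (\det A)^-1 by rewrite exprVn rootCK.
have c1 : `|c| = 1.
  have : `|c| ^+ 3 = 1 by rewrite -normrX c3 normfV dA1 invr1.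
  by move/eqP; rewrite pexpr_eq1 // => /eqP.
have c0 : c != 0 by rewrite -normr_eq0 c1 oner_neq0.
exists (c *: A); split; first exact: U21_scale.
  by rewrite detZ c3 mulVf.
exact/acts_scale/represents_acts/rA/U21_unitmx.
Qed.

(** * Lifts of an invariant set of points, equivariant up to cube roots of unity *)

Section EquivariantLifts.
Variables (H : set (CP2 -> CP2)) (P : set CP2).
Hypothesis H_PU21 : H `<=` PU21 (R := R).
Hypothesis H_id : H id.
Hypothesis H_comp : forall g h, H g -> H h -> H (g \o h).
Hypothesis H_inv : forall g, H g -> exists h, [/\ H h, cancel g h & cancel h g].
Hypothesis H_P : forall g p, H g -> P p -> P (g p).
Hypothesis H_unipotent : forall g p, H g -> P p -> g p = p ->
  purely_parabolic g \/ g = id.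

Definition special A g := [/\ U21 A, \det A = 1, H g & acts A g].

Lemma special_mul A B g h : special A g -> special B h ->
  special (A *m B) (g \o h).
Proof.
move=> [UA dA Hg aA] [UB dB Hh aB]; split; first exact: U21_mul.
- by rewrite det_mulmx dA dB mulr1.
- exact: H_comp.
- exact: acts_mul.
Qed.

Lemma special_inv A g : special A g -> exists2 h, cancel g h & special (invmx A) h.
Proof.
move=> [UA dA Hg aA]; have [h [Hh gK hK]] := H_inv Hg; exists h => //.
split; rewrite ?det_inv ?dA ?invr1 //; first exact: U21_inv.
by apply: acts_inv aA hK; exact: U21_unitmx.
Qed.

Lemma special_exists g : H g -> exists A, special A g.
Proof. by move=> Hg; have [A []] := PU21_special (H_PU21 Hg); exists A. Qed.

(* This is where parabolicity is used: the stabilizer of a vertex acts on its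
   lifts through cube roots of unity. *)
Lemma special_eigen A g p v : special A g -> P p -> g p = p -> lifts v p ->
  exists2 t, t ^+ 3 = 1 & A *m v = t *: v.
Proof.
move=> [UA dA Hg aA] Pp gp vp.
have [B [uB unB aB]] : exists B, [/\ B \in unitmx, unipotent B & acts B g].
  have [[_ [B [UB unB rB]]]|->] := H_unipotent Hg Pp gp.
    have uB := U21_unitmx UB; exists B; split=> //; exact: represents_acts.
  exists 1%:M; rewrite unitmx1; split=> //; last exact: acts_id.
  by exists 1%N; rewrite subrr expr1.
(* Both determinants are 1, so [t ^+ 3 = 1]. *)
have [t tE] := acts_proportional uB aA aB; exists t.
  by move: dA; rewrite tE detZ unipotent_det // mulr1.
have [s sE] : exists s, B *m v = s *: v.
  by have := aB _ _ vp; rewrite gp; exact: lifts_collinear.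
by rewrite tE -scalemxAl sE (unipotent_eigen unB _ sE) ?scale1r //; case: vp.
Qed.

Lemma equivariant_lifts : exists L : CP2 -> vec, forall p, P p ->
  lifts (L p) p /\ forall A g, special A g ->
    exists2 t, t ^+ 3 = 1 & A *m L p = t *: L (g p).
Proof.
(* Choose one lift of one point in each orbit, and transport it by [special]
   matrices. *)
pose orbit p := [set q | exists2 g, H g & q = g p].
pose base p := xget 0 [set v | exists2 q, orbit p q & lifts v q].
pose L p := xget 0 [set w | lifts w p /\ exists A g, special A g /\ w = A *m base p].
have orbitM g p : H g -> orbit (g p) = orbit p.
  move=> Hg; have [g' [Hg' gK _]] := H_inv Hg.
  apply/seteqP; split=> q [h Hh ->].
    by exists (h \o g) => //; exact: H_comp.
  by exists (h \o g'); [exact: H_comp|rewrite /= gK].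
(* [base] is chosen from the orbit as a set, so it is constant along the orbit. *)
have baseM g p : H g -> base (g p) = base p by move=> Hg; rewrite /base orbitM.
have baseP p : exists2 q, orbit p q & lifts (base p) q.
  rewrite /base; case: xgetP => [_ _ //|/(_ (hat p)) []].
  by exists p; [exists id|exact: lifts_hat].
have LP p : lifts (L p) p /\ exists A g, special A g /\ L p = A *m base p.
  rewrite /L; case: xgetP => [_ _ //|none].
  have [q [g Hg qE] bq] := baseP p; have [g' [Hg' gK _]] := H_inv Hg.
  have [A sA] := special_exists Hg'; case: (none (A *m base p)).
  split; last by exists A, g'.
  by have [_ _ _ aA] := sA; have := aA _ _ bq; rewrite qE gK.
exists L => p Pp; split; first by case: (LP p).
move=> A g sA; have [Lp [B [b [sB LpE]]]] := LP p.
have [Lgp [B' [b' [sB' LgpE]]]] := LP (g p).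
have Hg : H g by case: sA.
rewrite baseM // in LgpE.
have [q [h Hh qE] bq] := baseP p.
have Pq : P q by rewrite qE; exact: H_P.
have UB' : B' \in unitmx by case: sB' => /U21_unitmx.
have [c b'K sC] := special_inv sB'.
(* [B'] and [A *m B] both carry the base lift to a lift of [g p]. They thus differ by an element of
   the stabilizer of [q], which scales the base lift by a cube root of unity. *)
have fixq : (c \o (g \o b)) q = q.
  have bqp : b q = p.
    by have [_ _ _ aB] := sB; apply: lifts_inj (aB _ _ bq) _; rewrite -LpE.
  have b'qp : b' q = g p.
    by have [_ _ _ aB'] := sB'; apply: lifts_inj (aB' _ _ bq) _; rewrite -LgpE.
  by rewrite /= bqp -b'qp b'K.
have [t t3 tE] := special_eigen (special_mul sC (special_mul sA sB)) Pq fixq bq.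
by exists t => //; rewrite LpE LgpE scalemxAr -tE !mulmxA mulmxV // mul1mx.
Qed.

End EquivariantLifts.
End SpecialLifts.

Lemma PU21_inj (R : realType) (g : CP2 R -> CP2 R) : PU21 g -> injective g.
Proof.
move=> /PU21_special[A [UA _ aA]] p q gpq.
have vp := lifts_hat p; have wq := lifts_hat q.
have := aA _ _ wq; rewrite -gpq => Aw.
have [t tE] := lifts_collinear (aA _ _ vp) Aw.
have wE : hat q = t *: hat p.
  by rewrite -(mulKmx (U21_unitmx UA) (hat q)) tE -scalemxAr mulKmx ?U21_unitmx.
apply: (lifts_inj _ wq); rewrite wE; apply: lifts_scale vp.
by case: wq => + _; apply: contraNneq => t0; rewrite wE t0 scale0r.
Qed.

(** * The holonomy representation has a group as its image *)

Section Holonomy.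
Variables (R : realType) (M : topologicalType) (A : cr_atlas R M)
  (D : development A).

Lemma deck_id : deck (@dv_proj _ _ _ D) id.
Proof.
by split=> // [x|]; [exact: cvg_id|exists id; split=> // x; exact: cvg_id].
Qed.

Lemma deck_comp f h : deck (@dv_proj _ _ _ D) f -> deck (@dv_proj _ _ _ D) h ->
  deck (@dv_proj _ _ _ D) (f \o h).
Proof.
move=> [cf [f' [cf' fK f'K]] Ef] [ch [h' [ch' hK h'K]] Eh]; split.
- by move=> x; apply: continuous_comp; [exact: ch|exact: cf].
- exists (h' \o f'); split; [|exact: can_comp|exact: can_comp].
  by move=> x; apply: continuous_comp; [exact: cf'|exact: ch'].
- by move=> y /=; rewrite Ef Eh.
Qed.

Lemma deck_inv f : deck (@dv_proj _ _ _ D) f ->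
  exists h, [/\ deck (@dv_proj _ _ _ D) h, cancel f h & cancel h f].
Proof.
move=> [cf [f' [cf' fK f'K]] Ef]; exists f'; split=> //; split=> //.
  by exists f; split.
by move=> y; rewrite -[in RHS](f'K y) Ef.
Qed.

(** Multiplicativity makes this map idempotent, and an injective idempotent is the identity. *)
Lemma dv_hol_id : @dv_hol _ _ _ D id = id.
Proof.
apply/funext => p; apply: (PU21_inj (dv_hol_PU21 deck_id)).
by have /(congr1 (@^~ p)) := dv_hol_comp deck_id deck_id.
Qed.

Lemma holonomy_inv g : holonomy_group D g ->
  exists h, [/\ holonomy_group D h, cancel g h & cancel h g].
Proof.
move=> [f df <-]; have [f' [df' fK f'K]] := deck_inv df.
exists (@dv_hol _ _ _ D f'); split; first by exists f'.
- move=> p; have /(congr1 (@^~ p)) /= <- := dv_hol_comp df' df.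
  by rewrite (_ : f' \o f = id) ?dv_hol_id //; exact/funext.
- move=> p; have /(congr1 (@^~ p)) /= <- := dv_hol_comp df df'.
  by rewrite (_ : f \o f' = id) ?dv_hol_id //; exact/funext.
Qed.

Lemma holonomy_comp g h : holonomy_group D g -> holonomy_group D h ->
  holonomy_group D (g \o h).
Proof.
move=> [f df <-] [f' df' <-]; exists (f \o f'); first exact: deck_comp.
exact: dv_hol_comp.
Qed.

End Holonomy.

(** * Vertices of the facets and their images under the gluing *)

Section Vertices.
Variable R : realType.

Lemma facet_vertex (i j : 'I_4) : j != i -> facet i (vertex R j).
Proof.
move=> ji; split; last by rewrite /= mxE eqxx eq_sym (negPf ji).
split=> [m|]; first by rewrite mxE ler0n.
rewrite (bigD1 j) //= mxE !eqxx big1 ?addr0 // => m /negPf mj.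
by rewrite mxE mj andbF.
Qed.

Lemma facet_map_vertex k (G : gluing k) s i j :
  facet_map G s i (vertex R j) = vertex R (lab G s i j).
Proof.
apply/rowP => m; rewrite !mxE eqxx /=; congr (_%:R); congr nat_of_bool.
by rewrite -(inj_eq (@perm_inj _ (lab G s i))) permKV.
Qed.

End Vertices.

Lemma exists_third (i j : 'I_4) : exists l, (l != i) && (l != j).
Proof.
apply/existsP; rewrite -[[exists _, _]]negbK negb_exists; apply/negP => /forallP all.
have := card_size [:: i; j]; rewrite (_ : #|[:: i; j]| = 4) //.
rewrite -[RHS](card_ord 4); apply: eq_card => l; rewrite !inE.
by have := all l; rewrite negb_and !negbK.
Qed.

Theorem theorem4p13 (R : realType) (M : topologicalType) (A : cr_atlas R M)
    (hM : spherical_cr A) (D : development A) (k : nat)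
    (K : ideal_triangulation R M k) (T : cr_triangulation D K)
    (noncompact : ~ compact [set: M])
    (parabolic_boundary : purely_parabolic_boundary T) :
  bloch_group R[i] (beta T).
Proof.
pose H := holonomy_group D; pose P := developed_vertices T.
have H_PU21 : H `<=` PU21 (R := R) by move=> _ [f df <-]; exact: dv_hol_PU21.
have H_id : H id by exists id; [exact: deck_id|exact: dv_hol_id].
have H_P g p : H g -> P p -> P (g p).
  move=> Hg [h [s [i [Hh ->]]]]; exists (g \o h), s, i.
  by split=> //; exact: holonomy_comp.
have [L LP] := equivariant_lifts H_PU21 H_id (@holonomy_comp _ _ _ D)
  (@holonomy_inv _ _ _ D) H_P parabolic_boundary.
pose p s m := ct_dev T s (vertex R m); pose v s m := L (p s m).
have Pp s m : P (p s m) by exists id, s, m.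
have v_lifts s m : lifts (v s m) (p s m) by case: (LP _ (Pp s m)).
have p_generic s : generic (p s) by exact: ct_generic.
(* A lift of the side pairing to SU(2,1) matches the lifts at the three vertices of a facet with
   those of the glued facet, up to cube roots of unity. *)
have glue s i : exists2 B, U21 B /\ \det B = 1 & forall m, m != i ->
    exists2 t, t ^+ 3 = 1 &
      B *m v s m = t *: v (nbr (tr_glue K) s i) (lab (tr_glue K) s i m).
  have Hg : H (@dv_hol _ _ _ D (ct_side T s i)).
    by exists (ct_side T s i); first exact: ct_side_deck.
  have [B sB] := special_exists H_PU21 Hg; exists B; first by case: sB.
  move=> m mi; have [_ /(_ _ _ sB)[t t3 tE]] := LP _ (Pp s m); exists t => //.
  by rewrite tE /p ct_side_dev ?facet_map_vertex //; exact: facet_vertex.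
apply: (delta_sum_eq0 (fun s => delta_beta_tetra (p_generic s) (v_lifts s))).
apply: (sum_glued (a := fun s => ecoord (v s)) (d := fun s => fcoord (v s))
  (G := tr_glue K)).
(* A third vertex is needed because the product of two null lifts is shown nonzero through a
   determinant. *)
- move=> s i j ij; have [l /andP[li lj]] := exists_third i j.
  by apply: (ecoord_neq0 (p_generic s) (v_lifts s) ij (k := l)); rewrite eq_sym.
- by move=> s i j l; exact: fcoord_neq0.
- by move=> s i j l; exact: det3_swap.
- by move=> s i j l; exact: det3_rot.
(* [B] preserves the form, so the two edge coordinates differ by [t * r^*], a cube root of unity. *)
- move=> s i x y xi yi; have [B [UB _] gl] := glue s i.
  have [t t3 tE] := gl x xi; have [r r3 rE] := gl y yi.
  rewrite /ecoord -(herm_U21 _ _ UB) tE rE hermZ; apply: (@eqmuM _ 3) => //.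
  by rewrite exprMn r3 mul1r -rmorphXn t3 rmorph1.
(* As [\det B = 1], the face coordinates differ by the product of three cube roots of unity. *)
- move=> s i x y z xi yi zi; have [B [_ dB] gl] := glue s i.
  have [t t3 tE] := gl x xi; have [r r3 rE] := gl y yi; have [q q3 qE] := gl z zi.
  rewrite /fcoord -[det3 _ _ _]mul1r -dB -det3_mul tE rE qE det3Z.
  by apply: (@eqmuM _ 3) => //; rewrite !exprMn t3 r3 q3 !mul1r.
Qed.
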